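(* Let $G$ be the automorphism group of the Fraïssé limit of $\mathcal C$, where $\mathcal C$ is either the class of all finite $\omega$-partite tournaments or the class of all finite semigeneric tournaments. Then: (1) $G$ has the small index property. (2) $G$ has uncountable cofinality. (3) $G$ has properties (FA) and (FH). (4) $G$ has the $21$-Bergman property.
   Context: A directed graph is a structure with one binary relation which is irreflexive and antisymmetric (no loops, no bi-directional edges). A directed graph $\mathbf A$ is an $\omega$-partite tournament if its vertex set can be partitioned into countably many (possibly empty) pairwise disjoint sets $A_1,A_2,\ldots$, called parts, such that every pair of vertices in different parts is connected by a directed edge (in exactly one direction) and there are no edges between vertices in the same part. The parts are not named by the language. An $\omega$-partite tournament $\mathbf A$ is semigeneric if for every pair of parts $X$ and $Y$ of $\mathbf A$, and every $a\neq b\in X$ and $c\neq d\in Y$, the number of edges directed from $\{a,b\}$ to $\{c,d\}$ is even. A structure is homogeneous if every isomorphism between its finite substructures extends to an automorphism. The Fraïssé limit of a class $\mathcal C$ of finite structures is the (unique up to isomorphism) countable homogeneous structure such that the finite structures embedding into it are exactly the members of $\mathcal C$. The automorphism group of a countable structure carries the topology of pointwise convergence. Small index property: every subgroup of $G$ of index less than $2^{\aleph_0}$ is open. Uncountable cofinality: $G$ is not the union of a countable increasing chain of proper subgroups. Property (FA): every action of $G$ (as an abstract group) without inversions on a tree fixes a vertex. Property (FH): every action of $G$ (as an abstract group) by affine isometries on a real Hilbert space has a fixed point. $k$-Bergman property: whenever $W_0\subseteq W_1\subseteq W_2\subseteq\cdots$ are subsets of $G$ with $G=\bigcup_n W_n$,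 there is $n$ such that $W_n^k=G$, where $W^k$ is the set of products of $k$ elements of $W$. *)

(* Defs.v *)
From HB Require Import structures.
From mathcomp Require Import all_boot all_order all_algebra.
From mathcomp Require Import all_classical all_reals all_analysis.

Set Implicit Arguments.
Unset Strict Implicit.
Unset Printing Implicit Defensive.

Import GRing.Theory Num.Theory numFieldNormedType.Exports.

Local Open Scope classical_set_scope.
Local Open Scope card_scope.

Section Digraphs.
Variables (V : Type) (E : rel V).

Definition directed_graph : Prop := irreflexive E /\ antisymmetric E.

(* The parts are the fibres of [part], so a part may be empty. *)
Definition tournament_parts (part : V -> nat) : Prop :=
  forall x y, if part x == part y then ~~ E x y else E x y (+) E y x.

Definition omega_partite_tournament : Prop :=
  directed_graph /\ exists part, tournament_parts part.

(* The sum counts the edges from {a, b} to {c, d}; if the two parts coincide it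
   is 0, so the case of equal parts need not be excluded. *)
Definition semigeneric_tournament : Prop :=
  directed_graph /\ exists part, tournament_parts part /\
    forall a b c d, part a = part b -> a <> b -> part c = part d -> c <> d ->
      ~~ odd (E a c + E a d + E b c + E b d).

End Digraphs.

(* The inverse is stored as data; being unique, it carries no information. *)
Record automorphism (V : Type) (E : rel V) := Automorphism {
  aut_fun :> V -> V;
  aut_inv : V -> V;
  aut_funK : cancel aut_fun aut_inv;
  aut_invK : cancel aut_inv aut_fun;
  aut_edge : forall x y, E (aut_fun x) (aut_fun y) = E x y
}.

Section AutomorphismGroup.
Variables (V : Type) (E : rel V).
Implicit Types g h : automorphism E.

Lemma aut_ext g h : g =1 h -> g = h.
Proof.
case: g h => [f f' fK f'K fE] [k k' kK k'K kE] /= fk.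
have {}fk : f = k by apply/funext.
subst k; have f'k' : f' = k'.
  by apply/funext => x; rewrite -{1}[x]k'K fK.
by subst k'; congr Automorphism; exact: Prop_irrelevance.
Qed.

Definition aut_one : automorphism E :=
  @Automorphism V E id id (fun=> erefl) (fun=> erefl) (fun _ _ => erefl).

Definition aut_mul g h : automorphism E.
Proof.
apply: (@Automorphism V E (g \o h) (aut_inv h \o aut_inv g)).
- by move=> x /=; rewrite !aut_funK.
- by move=> x /=; rewrite !aut_invK.
- by move=> x y /=; rewrite !aut_edge.
Defined.

Definition aut_opp g : automorphism E.
Proof.
apply: (@Automorphism V E (aut_inv g) g (@aut_invK _ _ g) (@aut_funK _ _ g)).
by move=> x y; rewrite -(aut_edge g) !aut_invK.
Defined.

HB.instance Definition _ := gen_eqMixin (automorphism E).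
HB.instance Definition _ := gen_choiceMixin (automorphism E).

Lemma aut_mulA : associative aut_mul.
Proof. by move=> g h k; apply: aut_ext. Qed.
Lemma aut_mul1g : left_id aut_one aut_mul.
Proof. by move=> g; apply: aut_ext. Qed.
Lemma aut_mulg1 : right_id aut_one aut_mul.
Proof. by move=> g; apply: aut_ext. Qed.
Lemma aut_mulVg : left_inverse aut_one aut_opp aut_mul.
Proof. by move=> g; apply: aut_ext => x /=; rewrite aut_funK. Qed.
Lemma aut_mulgV : right_inverse aut_one aut_opp aut_mul.
Proof. by move=> g; apply: aut_ext => x /=; rewrite aut_invK. Qed.

HB.instance Definition _ := isGroup.Build (automorphism E)
  aut_mulA aut_mul1g aut_mulg1 aut_mulVg aut_mulgV.

End AutomorphismGroup.

(* Pointwise convergence, the vertex set being discrete. *)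
HB.instance Definition _ (V : choiceType) (E : rel V) :=
  Topological.copy (automorphism E)
    (initial_topology
      (@aut_fun V E : automorphism E -> {ptws V -> discrete_topology V})).

Section FraisseLimit.
Variables (V : Type) (E : rel V).

(* [f] restricts to an isomorphism between the substructures on [A] and [B]. *)
Definition homogeneous : Prop :=
  forall (A B : set V) (f : V -> V), finite_set A -> set_bij A B f ->
    (forall x y, A x -> A y -> E (f x) (f y) = E x y) ->
    exists g : automorphism E, forall x, A x -> g x = f x.

Definition embeds (T : Type) (e : rel T) : Prop :=
  exists f : T -> V, injective f /\ forall x y, E (f x) (f y) = e x y.

Definition is_fraisse_limit (C : forall T : finType, rel T -> Prop) : Prop :=
  [/\ countable [set: V], homogeneous
    & forall (T : finType) (e : rel T), embeds e <-> C T e].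

End FraisseLimit.

Section GroupProperties.
Variable G : groupType.
Local Open Scope group_scope.

Definition is_subgroup (H : set G) : Prop := group_closed (mem H).

Definition left_cosets (H : set G) : set (set G) :=
  [set [set g * h | h in H] | g in [set: G]].

Definition small_index_property (opens : set (set G)) : Prop :=
  forall H : set G, is_subgroup H ->
    left_cosets H #<= [set: set nat] -> left_cosets H #!= [set: set nat] ->
    opens H.

Definition uncountable_cofinality : Prop :=
  ~ exists H : nat -> set G,
      [/\ forall n, is_subgroup (H n) /\ H n <> [set: G],
          forall n, H n `<=` H n.+1
        & \bigcup_n H n = [set: G]].

Definition is_group_action (X : Type) (act : G -> X -> X) : Prop :=
  (forall x, act 1 x = x) /\ (forall g h x, act (g * h) x = act g (act h x)).

Definition has_fixed_point (X : Type) (act : G -> X -> X) : Prop :=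
  exists x, forall g, act g x = x.

Definition is_tree (T : eqType) (adj : rel T) : Prop :=
  [/\ symmetric adj, irreflexive adj,
      exists x : T, True,
      forall x y, exists p, path adj x p /\ last x p = y
    & forall c : seq T, 2 < size c -> uniq c -> ~~ cycle adj c].

Definition property_FA : Prop :=
  forall (T : eqType) (adj : rel T) (act : G -> T -> T),
    is_tree adj -> is_group_action act ->
    (forall g x y, adj (act g x) (act g y) = adj x y) ->
    (forall g x y, adj x y -> ~ (act g x = y /\ act g y = x)) ->
    has_fixed_point act.

Definition affine_isometry (R : realType) (H : normedModType R) (f : H -> H) :
    Prop :=
  (forall (t : R) x y,
     f (t *: x + (1 - t) *: y)%R = (t *: f x + (1 - t) *: f y)%R) /\
  (forall x y, `|f x - f y|%R = `|x - y|%R).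

(* A real Hilbert space is a complete normed space whose norm comes from an
   inner product. *)
Definition property_FH : Prop :=
  forall (R : realType) (H : completeNormedModType R) (dot : {dot H for idfun}%R)
      (act : G -> H -> H),
    (forall x, `|x| ^+ 2 = dot x x)%R ->
    is_group_action act -> (forall g, affine_isometry (act g)) ->
    has_fixed_point act.

Definition set_power (k : nat) (W : set G) : set G :=
  [set \prod_(i < k) w i | w in [set w : 'I_k -> G | forall i, W (w i)]].

Definition bergman_property (k : nat) : Prop :=
  forall W : nat -> set G, (forall n, W n `<=` W n.+1) ->
    \bigcup_n W n = [set: G] -> exists n, set_power k (W n) = [set: G].

End GroupProperties.

(* Main.v *)
(* Semigeneric tournaments and omega-partite tournaments have the extension
   property for partial automorphisms (EPPA): a structure embeds into a finite
   one whose vertices are colourings of a set of base points, where partial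
   automorphisms extend to permutations of the base corrected by flips of
   colours. Cofinally many finite structures moreover serve as the base of an
   amalgamation that is functorial for automorphisms. These two facts make
   comeager many tuples generic, so that any two sequences chosen generically
   from non-meager pieces of the group are conjugate. Conjugating the mixtures
   of a sequence in H and a sequence outside H yields continuum many cosets of a
   subgroup H that is not open; conjugating a sequence x_n of short products of
   elements of W_n to a sequence y_n of elements that are not short products
   shows that bounded products of elements of some W_n cover an open subgroup,
   hence, by oligomorphicity, the group. The Bergman property bounds the orbits
   of isometric actions, and bounded orbits in trees and in Hilbert spaces have
   a centre fixed by the group. *)
Require Import Defs.
From mathcomp Require Import all_boot all_order all_algebra perm.
From mathcomp Require Import all_classical all_reals all_analysis.
From mathcomp Require Import ring lra.

Set Implicit Arguments.
Unset Strict Implicit.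
Unset Printing Implicit Defensive.

(** * Comeager sets in closed permutation groups *)

Reserved Notation "g \! v" (at level 38, right associativity).

(** The obstacle is amalgamation of automorphisms over a finite base in the semigeneric case. Let
    [u] lie in a part meeting the base in [a], and let [Y] be a part of the other copy that misses
    the base. Parity forces the edges from [u] to [Y] to agree with those of [a] or to be their
    complement, which leaves one binary choice. Settling it by an arbitrarily chosen [a] is not
    invariant under automorphisms, since another base point of the same part may give the opposite
    answer. Bases are therefore restricted to [good] lists, in which every vertex of a part meeting
    the base has exactly one twin with the same edges to the base; the twin decides canonically.
    Such lists are cofinal because the EPPA witnesses can be built saturated. Genericity of a tuple
    is phrased as an extension property over good bases rather than by comeager conjugacy classes:
    conjugacy then becomes a back-and-forth argument that can start from any finite partial
    conjugation, which is what an inductive construction of conjugators needs. *)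

Lemma indexed_dependent_choice (T : Type) (P : nat -> T -> Prop)
    (R : nat -> T -> T -> Prop) (x0 : T) :
    P 0 x0 -> (forall n x, P n x -> exists y, P n.+1 y /\ R n x y) ->
  exists f : nat -> T, [/\ f 0 = x0, forall n, P n (f n)
    & forall n, R n (f n) (f n.+1)].
Proof.
move=> P0 step.
have /choice[F FP] : forall p : nat * T, exists y, P p.1 p.2 ->
    P p.1.+1 y /\ R p.1 p.2 y.
  move=> [n x] /=; have [/step[y yP]|nPx] := pselect (P n x).
    by exists y.
  by exists x.
pose f := nat_rect (fun=> T) x0 (fun n x => F (n, x)).
have fP n : P n (f n) by elim: n => // n IHn; exact: (FP (n, f n) IHn).1.
by exists f; split=> // n; exact: (FP (n, f n) (fP n)).2.
Qed.

Section PermutationGroup.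
Variables (V : eqType) (G : groupType) (act : G -> V -> V) (en : nat -> V).
Local Open Scope group_scope.
Local Notation "g \! v" := (act g v).

Hypothesis act1 : forall v, 1 \! v = v.
Hypothesis actM : forall g h v, (g * h) \! v = g \! h \! v.
Hypothesis act_faithful : forall g h, act g =1 act h -> g = h.
Hypothesis act_closed : forall h : V -> V, injective h ->
  (forall w, exists v, h v = w) ->
  (forall A : seq V, exists g, {in A, act g =1 h}) -> exists g, act g =1 h.
Hypothesis en_surj : forall v, exists n, en n = v.

Lemma actK g : cancel (act g) (act g^-1).
Proof. by move=> v; rewrite -actM mulVg act1. Qed.

Lemma actVK g : cancel (act g^-1) (act g).
Proof. by move=> v; rewrite -actM mulgV act1. Qed.

Lemma act_inj g : injective (act g).
Proof. exact: can_inj (actK g). Qed.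

(** The third hypothesis makes the pointwise limit total and the fourth makes it surjective;
    closedness of the group does the rest. *)
Lemma act_limit (g : nat -> G) (A : nat -> seq V) :
    (forall n, {subset A n <= A n.+1}) ->
    (forall n, {in A n, act (g n.+1) =1 act (g n)}) ->
    (forall n, en n \in A n.+1) ->
    (forall n, en n \in map (act (g n.+1)) (A n.+1)) ->
  exists u, forall n, {in A n, act u =1 act (g n)}.
Proof.
move=> Asub gE enA enI.
have Amono m n : m <= n -> {subset A m <= A n}.
  move=> /subnK <-; elim: (n - m)%N => [|k IHk] v vA; first by rewrite add0n.
  by rewrite addSn; apply/Asub/IHk.
have gmono m n : m <= n -> {in A m, act (g n) =1 act (g m)}.
  move=> /subnK <-; elim: (n - m)%N => [|k IHk] v vA; first by rewrite add0n.
  by rewrite addSn gE ?IHk//; apply: Amono vA; rewrite leq_addl.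
have /choice[N NP] : forall v, exists n, v \in A n.
  by move=> v; have [n <-] := en_surj v; exists n.+1.
pose h v := g (N v) \! v.
have hE n v : v \in A n -> h v = g n \! v.
  move=> vA; rewrite /h; have [le|/ltnW le] := leqP (N v) n.
    by rewrite -(gmono _ _ le).
  by rewrite (gmono _ _ le).
have inA v w : exists2 n, v \in A n & w \in A n.
  exists (maxn (N v) (N w)).
    by apply: Amono (NP v); rewrite leq_maxl.
  by apply: Amono (NP w); rewrite leq_maxr.
have [v w|w|B|u uE] := act_closed (h := h).
- by have [n vA wA] := inA v w; rewrite !(hE n)//; exact: act_inj.
- have [n <-] := en_surj w; have /mapP[v vA ->] := enI n.
  by exists v; rewrite (hE n.+1).
- have [n Bn] : exists n, {subset B <= A n}.
    elim: B => [|v B [n IHB]]; first by exists 0.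
    exists (maxn (N v) n) => w; rewrite inE => /orP[/eqP->|/IHB].
      by apply: Amono (NP v); rewrite leq_maxl.
    by apply: Amono; rewrite leq_maxr.
  by exists (g n) => v /Bn /hE.
- by exists u => n v vA; rewrite uE (hE n).
Qed.

(** The elements agreeing with [g] on a finite list form a basic open set, so this says that [D]
    contains a dense open set. *)
Definition dense_interior (D : G -> Prop) : Prop :=
  forall g (A : seq V), exists g' (B : seq V), {in A, act g' =1 act g} /\
    forall u, {in B, act u =1 act g'} -> D u.

Definition comeager (D : G -> Prop) : Prop :=
  exists2 D' : nat -> G -> Prop, (forall i, dense_interior (D' i)) &
    forall g, (forall i, D' i g) -> D g.

Lemma baire D g (A : seq V) : comeager D -> exists2 u, D u & {in A, act u =1 act g}.
Proof.
move=> [D' D'd D'D].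
pose R n (p q : G * seq V) := [/\ {subset p.2 <= q.2},
  {in p.2, act q.1 =1 act p.1}, en n \in q.2, en n \in map (act q.1) q.2
  & forall u, {in q.2, act u =1 act q.1} -> D' n u].
have [//|n [h B] _ /=|f [f0 _ fR]] :=
    @indexed_dependent_choice _ (fun _ _ => True) R (g, A).
  have [h' [B' [h'E h'D]]] := D'd n h B.
  (* Adding both the n-th point and its preimage makes the nested basic open sets shrink to a
     permutation, not merely to an injection. *)
  exists (h', en n :: h'^-1 \! en n :: B ++ B'); split=> //=; split=> //=.
  - by move=> v vB; rewrite !inE mem_cat vB !orbT.
  - by rewrite inE eqxx.
  - by rewrite !inE actVK eqxx orbT.
  - by move=> u uE; apply: h'D => v vB; rewrite uE// !inE mem_cat vB !orbT.
have [|n|n|n|u uE] := @act_limit (fun n => (f n).1) (fun n => (f n).2).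
- by move=> n; case: (fR n).
- by case: (fR n).
- by case: (fR n).
- by case: (fR n).
exists u; last by have := uE 0; rewrite f0.
by apply: D'D => n; case: (fR n) => _ _ _ _; apply; exact: uE.
Qed.

Lemma dense_interior_comeager D : dense_interior D -> comeager D.
Proof. by move=> Dd; exists (fun=> D) => // g gD; exact: (gD 0). Qed.

Lemma comeagerW D D' : (forall g, D g -> D' g) -> comeager D -> comeager D'.
Proof. by move=> DD' [F Fd FD]; exists F => // g /FD /DD'. Qed.

Lemma comeager_all (I : countType) (D : I -> G -> Prop) :
  (forall i, comeager (D i)) -> comeager (fun g => forall i, D i g).
Proof.
move=> Dc; have /choice[F FP] : forall i, exists F : nat -> G -> Prop,
    (forall m, dense_interior (F m)) /\ forall g, (forall m, F m g) -> D i g.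
  by move=> i; have [F Fd FD] := Dc i; exists F.
exists (fun n => if unpickle n is Some p then F p.1 p.2 else fun=> True).
  move=> n; case: unpickle => [[i m]|] /=; first exact: (FP i).1.
  by move=> g A; exists g, A.
move=> g gF i; apply: (FP i).2 => m.
by have := gF (pickle (i, m)); rewrite pickleK.
Qed.

Lemma comeagerI D D' : comeager D -> comeager D' ->
  comeager (fun g => D g /\ D' g).
Proof.
move=> Dc D'c; have /comeagerW : comeager (fun g => forall b : bool,
    (if b then D else D') g) by apply: comeager_all => -[].
by apply=> g gD; split; [exact: (gD true)|exact: (gD false)].
Qed.

Lemma comeager_translate D h : comeager D -> comeager (fun g => D (g * h)).
Proof.
move=> [F Fd FD]; exists (fun i g => F i (g * h)) => [i g A|g gF]; last first.
  exact: FD.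
have [g' [B [g'E g'F]]] := Fd i (g * h) (map (act h^-1) A).
exists (g' * h^-1), (map (act h) B); split=> [v vA|u uE].
  by rewrite actM g'E ?map_f// actM actVK.
by apply: g'F => v vB; rewrite actM uE ?map_f// actM actK.
Qed.

(** * Generic tuples *)

Definition stable g (A : seq V) := {in A, forall v, g \! v \in A}.
Definition fixes g (A : seq V) := {in A, forall v, g \! v = v}.

Variable good : seq V -> Prop.
Hypothesis good_act : forall g A, good A -> good (map (act g) A).
Hypothesis eppa : forall A : seq V, exists B : seq V,
  [/\ {subset A <= B}, good B
    & forall p (S : seq V), {subset S <= A} ->
        {in S, forall v, p \! v \in A} ->
        exists2 g, stable g B & {in S, act g =1 act p}].
(** Functoriality is in the order of quantifiers: [B2] is moved once, by a single [k], to a position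
    over [A] where every pair [f1], [f2] agreeing on [A] can be glued. *)
Hypothesis amalgamation : forall A B1 B2 : seq V,
  good A -> {subset A <= B1} -> {subset A <= B2} ->
  exists2 k, fixes k A & forall f1 f2,
    stable f1 B1 -> stable f1 A -> stable f2 B2 -> {in A, act f1 =1 act f2} ->
    exists2 f, {in B1, act f =1 act f1} & {in B2, forall b, f \! k \! b = k \! f2 \! b}.

Lemma eppa_family (A : seq V) : exists B : seq V,
  [/\ {subset A <= B}, good B
    & forall (I : Type) (P : I -> Prop) (p : I -> G) (S : I -> seq V),
        (forall i, P i -> {subset S i <= A} /\
          {in S i, forall v, p i \! v \in A}) ->
        exists g : I -> G, forall i, P i ->
          stable (g i) B /\ {in S i, act (g i) =1 act (p i)}].
Proof.
have [B [AB gB Bext]] := eppa A; exists B; split=> // I P p S pS.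
have /choice[g gP] : forall i, exists g, P i ->
    stable g B /\ {in S i, act g =1 act (p i)}.
  move=> i; have [/pS[SA pSA]|nPi] := pselect (P i); last by exists 1.
  by have [g gB' gE] := Bext _ _ SA pSA; exists g.
by exists g.
Qed.

Lemma amalgamation_family (A B1 B2 : seq V) :
    good A -> {subset A <= B1} -> {subset A <= B2} ->
  exists2 k, fixes k A & forall (I : Type) (P : I -> Prop) (f1 f2 : I -> G),
    (forall i, P i -> [/\ stable (f1 i) B1, stable (f1 i) A, stable (f2 i) B2
      & {in A, act (f1 i) =1 act (f2 i)}]) ->
    exists f : I -> G, forall i, P i -> {in B1, act (f i) =1 act (f1 i)} /\
      {in B2, forall b, f i \! k \! b = k \! f2 i \! b}.
Proof.
move=> gA AB1 AB2; have [k kA kP] := amalgamation gA AB1 AB2.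
exists k => // I P f1 f2 f12; have /choice[f fP] : forall i, exists f, P i ->
    {in B1, act f =1 act (f1 i)} /\
    {in B2, forall b, f \! k \! b = k \! f2 i \! b}.
  move=> i; have [/f12[f1B f1A f2B E]|nPi] := pselect (P i); last by exists 1.
  by have [f ? ?] := kP _ _ f1B f1A f2B E; exists f.
by exists f.
Qed.

(* The second clause is the extension property of the Fraisse limit of the finite
   structures endowed with n automorphisms; it makes generic tuples conjugate. *)
Definition generic_tuple n (z : nat -> G) : Prop :=
  (forall S : seq V, exists A : seq V,
     [/\ {subset S <= A}, good A & forall i, i < n -> stable (z i) A]) /\
  (forall (A B : seq V) (f : nat -> G), good A -> {subset A <= B} ->
     (forall i, i < n -> [/\ stable (z i) A, stable (f i) B
        & {in A, act (f i) =1 act (z i)}]) ->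
     exists2 k, fixes k A & forall i, i < n ->
       {in B, forall b, k \! f i \! b = z i \! k \! b}).

Lemma generic_tuple0 z : generic_tuple 0 z.
Proof.
split=> [S|A B f _ _ _]; last by exists 1 => // v _; rewrite act1.
by have [B [SB gB _]] := eppa S; exists B.
Qed.

(** An extension problem for the subtuple is completed to one for all of [w]: enlarge [A] to a base
    [A'] stable under every entry, amalgamate it with [B] over [A], and use EPPA to make all the
    coordinates total on a common finite list. *)
Lemma generic_tuple_sub m n w (r : nat -> nat) : generic_tuple m w ->
    (forall i, i < n -> r i < m) ->
    (forall i j, i < n -> j < n -> r i = r j -> i = j) ->
  generic_tuple n (w \o r).
Proof.
move=> [wA wB] rm rI; split=> [S|A B f gA AB fP].
  by have [A [SA gA As]] := wA S; exists A; split=> // i /rm /As.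
have [A' [AA' gA' A's]] := wA A.
have [k0 k0A k0P] := amalgamation_family gA AA' AB.
have [i lin|f' f'P] := k0P nat (fun i => i < n) (w \o r) f.
  have [wsA fB fw] := fP i lin; split=> //=; first exact/A's/rm.
  by move=> v vA; rewrite /= fw.
pose C := A' ++ map (act k0) B.
have f'C i : i < n -> stable (f' i) C.
  move=> lin v; have [f'A' f'B] := f'P i lin; rewrite !mem_cat.
  move=> /orP[vA'|/mapP[b bB ->]]; first by rewrite f'A'//= A's ?rm.
  by rewrite f'B// map_f ?orbT//; have [_ + _] := fP i lin; exact.
have [D [CD gD DP]] := eppa_family C.
(* A partial map with its domain for each index: the amalgamated [f' i] on [C] at [j = r i], well
   defined as [r] is injective, and [w j] on [A'] at the other indices. *)
have /choice[q qP] : forall j, exists q : G * seq V, j < m ->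
    [/\ {subset q.2 <= C}, {in q.2, forall v, q.1 \! v \in C},
     {in A', act q.1 =1 act (w j)}, {subset A' <= q.2}
     & forall i, i < n -> r i = j -> q = (f' i, C)].
  move=> j; have [[i [lin rij]]|nij] := pselect (exists i, i < n /\ r i = j).
    exists (f' i, C) => _; split=> //=.
    - exact: f'C.
    - by rewrite -rij; exact: (f'P i lin).1.
    - by move=> v vA'; rewrite mem_cat vA'.
    - by move=> i' lin' ri'j; rewrite (rI i i')// rij ri'j.
  exists (w j, A') => ljm; split=> //=.
  - by move=> v vA'; rewrite mem_cat vA'.
  - by move=> v vA'; rewrite mem_cat A's.
  - by move=> i lin rij; case: nij; exists i.
have [j ljm|g gP] := DP nat (fun j => j < m) (fst \o q) (snd \o q).
  by have [] := qP j ljm.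
have [|j ljm|k1 k1A' k1P] := wB A' D g gA'.
- by move=> v vA'; apply: CD; rewrite mem_cat vA'.
- have [gs gq] := gP j ljm; have [_ _ qw qA' _] := qP j ljm; split=> //.
    exact: A's.
  by move=> v vA'; rewrite gq/= ?qA'// qw.
exists (k1 * k0) => [v vA|i lin b bB]; first by rewrite actM k0A// k1A'//; exact: AA'.
have bC : k0 \! b \in C by rewrite mem_cat map_f ?orbT.
rewrite !actM -(f'P i lin).2//= -k1P ?rm//; last exact: CD.
have [_ /(_ (k0 \! b)) /=] := gP _ (rm _ lin).
by have [_ _ _ _ /(_ i lin erefl)->] := qP _ (rm _ lin) => /= ->.
Qed.

Definition extend_tuple n (z : nat -> G) u i := if i < n then z i else u.

Lemma generic_tuple_extend n z : generic_tuple n z ->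
  comeager (fun u => generic_tuple n.+1 (extend_tuple n z u)).
Proof.
move=> [zA zB].
pose ext := extend_tuple n z.
have extz u i : i < n -> ext u i = z i by rewrite /ext /extend_tuple => ->.
have extn u : ext u n = u by rewrite /ext /extend_tuple ltnn.
pose closed_over u (S : seq V) := exists A : seq V,
  [/\ {subset S <= A}, good A & forall i, i < n.+1 -> stable (ext u i) A].
(* EPPA extends [z] on a stable [A] and [g] on [T] to one finite [B]. Genericity of [z] carries [B]
   back into place by [k] fixing [A], and the conjugate by [k] of the last extension is the required
   [u]. *)
have closed_dense g (T S : seq V) : exists u A,
    {in T, act u =1 act g} /\ [/\ {subset T <= A}, {subset S <= A}, good A
      & forall i, i < n.+1 -> stable (ext u i) A].
  have [A [SA gA As]] := zA (S ++ T ++ map (act g) T).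
  have [B [AB gB BP]] := eppa_family A.
  have [i|h hP] := BP nat (fun i => i < n.+1) (ext g)
      (fun i => if i < n then A else T).
    rewrite ltnS leq_eqVlt => /orP[/eqP->|lin].
      rewrite ltnn extn; split=> v vT; apply: SA.
        by rewrite !mem_cat vT !orbT.
      by rewrite !mem_cat map_f ?orbT.
    by rewrite lin extz//; split=> //; exact: As.
  have {}hz i : i < n -> stable (h i) B /\ {in A, act (h i) =1 act (z i)}.
    by move=> lin; have := hP i; rewrite lin extz//; apply; exact: ltnW.
  have {hP}hn : stable (h n) B /\ {in T, act (h n) =1 act g}.
    by have := hP n; rewrite ltnn extn; exact.
  have [|k kA kP] := zB A B h gA AB.
    by move=> i lin; have [] := hz i lin; split=> //; exact: As.
  exists (k * h n * k^-1), (map (act k) B); split.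
    move=> v vT; rewrite !actM; have vA : v \in A.
      by apply: SA; rewrite !mem_cat vT !orbT.
    rewrite -[in LHS](kA v vA) actK hn.2// kA//.
    by apply: SA; rewrite !mem_cat map_f ?orbT.
  have kB v : v \in A -> v \in map (act k) B.
    by move=> vA; rewrite -(kA v vA) map_f// AB.
  split; [| |exact: good_act|].
  - by move=> v vT; apply/kB/SA; rewrite !mem_cat vT !orbT.
  - by move=> v vS; apply/kB/SA; rewrite !mem_cat vS.
  - move=> i; rewrite ltnS leq_eqVlt => /orP[/eqP->|lin] w /mapP[b bB ->].
      by rewrite extn !actM actK map_f// hn.1.
    by rewrite extz// -kP// map_f//; exact: (hz i lin).1.
pose extends u (A B : seq V) (f : nat -> G) := good A -> {subset A <= B} ->
  (forall i, i < n.+1 -> [/\ stable (ext u i) A, stable (f i) B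
     & {in A, act (f i) =1 act (ext u i)}]) ->
  exists2 k, fixes k A & forall i, i < n.+1 ->
    {in B, forall b, k \! f i \! b = ext u i \! k \! b}.
have extI u u' (A : seq V) i : {in A, act u =1 act u'} ->
    {in A, act (ext u i) =1 act (ext u' i)}.
  by move=> uu'; rewrite /ext /extend_tuple; case: ifP.
have extends_dense A B f : dense_interior (fun u => extends u A B f).
  move=> g T; have [u1 [A' [u1T [TA' AA' gA' A's]]]] := closed_dense g T A.
  pose hyp u := [/\ good A, {subset A <= B} &
    forall i, i < n.+1 -> [/\ stable (ext u i) A, stable (f i) B
      & {in A, act (f i) =1 act (ext u i)}]].
  (* The hypotheses of the extension problem depend on [u] only through its values on [A]; if they
     fail at [u1], they fail on a neighbourhood and the problem is void there. *)
  have [[gA AB fP]|nhyp] := pselect (hyp u1); last first.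
    exists u1, A; split=> // u uu1 gA AB fP; case: nhyp; split=> // i lin.
    have [zs fs fz] := fP i lin; split=> // v vA.
      by rewrite -(extI u u1 A)// zs.
    by rewrite fz// (extI u u1 A).
  have [k0 k0A k0P] := amalgamation_family gA AA' AB.
  have [i lin|f' f'P] := k0P nat (fun i => i < n.+1) (ext u1) f.
    have [zs fs fz] := fP i lin; split=> //; first exact: A's.
    by move=> v vA; rewrite fz.
  have [|i lin|k1 k1A' k1P] := zB A' (A' ++ map (act k0) B) f' gA'.
  - by move=> v vA'; rewrite mem_cat vA'.
  - have lin' : i < n.+1 by exact: ltnW.
    have [f'A' f'B] := f'P i lin'; split.
    + by have := A's i lin'; rewrite extz.
    + move=> v; rewrite !mem_cat => /orP[vA'|/mapP[b bB ->]].
        by rewrite f'A'// (A's _ lin').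
      by rewrite f'B// map_f ?orbT//; have [_ + _] := fP i lin'; exact.
    + by move=> v vA'; rewrite f'A'// extz.
  pose u := k1 * f' n * k1^-1.
  have uA' : {in A', act u =1 act u1}.
    move=> v vA'; rewrite !actM -[in LHS](k1A' v vA') actK (f'P n _).1//.
    by rewrite extn k1A'//; have := A's n (ltnSn n); rewrite extn; exact.
  exists u, (A ++ map (act (k1 * k0)) B); split.
    by move=> v vT; rewrite uA' ?u1T//; exact: TA'.
  move=> u' u'u _ _ _; exists (k1 * k0) => [v vA|i].
    by rewrite actM k0A// k1A'//; exact: AA'.
  move=> lin b bB; have [_ f'B] := f'P i lin.
  rewrite !actM -f'B//; move: lin; rewrite ltnS leq_eqVlt => /orP[/eqP->|lin].
    rewrite extn u'u; last by rewrite mem_cat -actM map_f ?orbT.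
    by rewrite !actM actK.
  by rewrite extz// k1P// mem_cat map_f ?orbT.
pose seq_of s := map en s.
have seq_ofP (A : seq V) : exists s, seq_of s = A.
  elim: A => [|v A [s <-]]; first by exists [::].
  by have [m <-] := en_surj v; exists (m :: s).
(* Only the action of [f] on [B] matters, and it is coded by finite lists of indices, so the
   uncountably many extension problems reduce to countably many representatives [f0]. *)
have /choice[f0 f0P] : forall p : seq nat * seq (seq nat), exists f,
    (exists f' : nat -> G, forall i, i < n.+1 ->
       map (act (f' i)) (seq_of p.1) = seq_of (nth [::] p.2 i)) ->
    forall i, i < n.+1 -> map (act (f i)) (seq_of p.1) = seq_of (nth [::] p.2 i).
  move=> p; have [[f fP]|nf] := pselect (exists f' : nat -> G, forall i, i < n.+1 ->
    map (act (f' i)) (seq_of p.1) = seq_of (nth [::] p.2 i)).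
    by exists f.
  by exists z => /nf.
have /comeagerW : comeager (fun u => (forall s, closed_over u (seq_of s)) /\
    (forall p : seq nat * (seq nat * seq (seq nat)),
       extends u (seq_of p.1) (seq_of p.2.1) (f0 p.2))).
  apply: comeagerI; apply: comeager_all => s; last first.
    exact: dense_interior_comeager.
  apply: dense_interior_comeager => g T.
  have [u [A [uT [TA SA gA As]]]] := closed_dense g T (seq_of s).
  exists u, A; split=> // u' u'u; exists A; split=> // i lin v vA.
  by rewrite (extI u' u A)//; exact: As.
apply=> u [uS uE]; split=> [S|A B f gA AB fP].
  by have [s <-] := seq_ofP S; exact: uS.
have [a aA] := seq_ofP A; have [b bB] := seq_ofP B.
have /choice[M MP] : forall i, exists t, seq_of t = map (act (f i)) B.
  by move=> i; exact: seq_ofP.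
pose p := (b, mkseq M n.+1).
have f0f i : i < n.+1 -> {in B, act (f0 p i) =1 act (f i)}.
  move=> lin.
  have pE j : j < n.+1 ->
      map (act (f j)) (seq_of p.1) = seq_of (nth [::] p.2 j).
    by move=> ljn; rewrite nth_mkseq// MP bB.
  apply/eq_in_map; rewrite -[X in map _ X]bB -[X in _ = map _ X]bB.
  by rewrite (f0P p)// ?pE//; exists f.
have := uE (a, p); rewrite /= aA bB => -[//|//|i lin|k kA kP].
  have [zs fs fz] := fP i lin; split=> // v.
    by move=> vB; rewrite f0f// fs.
  by move=> vA; rewrite f0f ?fz// AB.
by exists k => // i lin v vB; rewrite -kP// f0f.
Qed.

Definition partial_conj n (z x : nat -> G) h (A : seq V) : Prop :=
  good A /\ forall i, i < n -> stable (z i) A /\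
    {in A, forall a, h \! z i \! a = x i \! h \! a}.

Lemma partial_conj_sym n z x h A : partial_conj n z x h A ->
  partial_conj n x z h^-1 (map (act h) A).
Proof.
move=> [gA zA]; split=> [|i lin]; first exact: good_act.
have [zs zc] := zA i lin; split=> _ /mapP[a aA ->].
  by rewrite -zc// map_f// zs.
by rewrite actK -zc// actK.
Qed.

(** Conjugated by [h], the tuple [z] on a larger stable [B] becomes an extension problem for [x]
    over the image of [A]; genericity of [x] solves it. *)
Lemma partial_conj_extend n z x h (A : seq V) v :
    generic_tuple n z -> generic_tuple n x -> partial_conj n z x h A ->
  exists h' B, [/\ {subset A <= B}, {in A, act h' =1 act h}, v \in B
    & partial_conj n z x h' B].
Proof.
move=> [zA _] [_ xB] [gA zh].
have [B [AB gB Bs]] := zA (v :: A).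
have [a aA|i lin|k kA kP] := xB (map (act h) A) (map (act h) B)
    (fun i => h * z i * h^-1) (good_act h gA).
- by move: aA => /mapP[b bA ->]; rewrite map_f// AB// inE bA orbT.
- have [zs zc] := zh i lin; split=> _ /mapP[a aA ->].
  + by rewrite -zc// map_f// zs.
  + by rewrite !actM actK map_f// Bs.
  + by rewrite !actM actK zc.
exists (k * h), B; split=> [a aA|a aA||].
- by apply: AB; rewrite inE aA orbT.
- by rewrite actM kA// map_f.
- by apply: AB; rewrite inE eqxx.
- split=> // i lin; split=> [|a aB]; first exact: Bs.
  by have := kP i lin (h \! a); rewrite !actM actK; apply; exact: map_f.
Qed.

Lemma partial_conj_back_and_forth n z x h (A : seq V) v :
    generic_tuple n z -> generic_tuple n x -> partial_conj n z x h A ->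
  exists h' B, [/\ {subset A <= B}, {in A, act h' =1 act h}, v \in B,
    v \in map (act h') B & partial_conj n z x h' B].
Proof.
move=> gz gx /(partial_conj_extend v gz gx)[h1 [B1 [AB1 h1h vB1 pc1]]].
have /(partial_conj_extend v gx gz)[h2 [B2 [B12 h2h vB2 pc2]]] :=
  partial_conj_sym pc1.
have h2K a : a \in B1 -> h2 \! h1 \! a = a.
  by move=> aB1; rewrite h2h ?map_f// actK.
have B1B2 a : a \in B1 -> a \in map (act h2) B2.
  by move=> aB1; rewrite -(h2K a aB1) map_f// B12// map_f.
exists h2^-1, (map (act h2) B2); split.
- by move=> a /AB1; exact: B1B2.
- by move=> a aA; rewrite -[in LHS](h2K a) ?actK ?h1h// AB1.
- exact: B1B2.
- by rewrite -map_comp map_id_in// => a _ /=; rewrite actK.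
- exact: partial_conj_sym.
Qed.

Lemma generic_conj n z x h (A : seq V) :
    generic_tuple n z -> generic_tuple n x -> partial_conj n z x h A ->
  exists2 u, {in A, act u =1 act h} & forall i, i < n -> u * z i = x i * u.
Proof.
move=> gz gx pc0.
have [//|m [g B] /= pc|f [f0 fP fR]] := @indexed_dependent_choice (G * seq V)
  (fun _ p => partial_conj n z x p.1 p.2)
  (fun m p q => [/\ {subset p.2 <= q.2}, {in p.2, act q.1 =1 act p.1},
    en m \in q.2 & en m \in map (act q.1) q.2]) (h, A).
  have [g' [B' [? ? ? ? ?]]] := partial_conj_back_and_forth (en m) gz gx pc.
  by exists (g', B').
have [|m|m|m|u uE] := @act_limit (fun m => (f m).1) (fun m => (f m).2).
- by move=> m; case: (fR m).
- by case: (fR m).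
- by case: (fR m).
- by case: (fR m).
exists u => [|i lin]; first by have := uE 0; rewrite f0.
apply: act_faithful => v; have [m <-] := en_surj v.
have [_ _ mf _] := fR m; have [_ /(_ i lin)[zs zc]] := fP m.+1.
by rewrite !actM !(uE m.+1)// ?zs//; exact: zc.
Qed.

(** Entries [2i] and [2i+1] of [w] are the two candidates for position [i]. Missing bits read as
    false, so [mix w [::]] is the first sequence. *)
Definition mix (w : nat -> G) (s : seq bool) i := w (nth false s i + i.*2)%N.

Lemma mix_lt (s : seq bool) i n : i < n -> nth false s i + i.*2 < n.*2.
Proof.
move=> lin; apply: (@leq_trans i.+1.*2); last by rewrite leq_double.
by rewrite doubleS; case: (nth _ _ _).
Qed.

Lemma generic_mix n w s : generic_tuple n.*2 w -> generic_tuple n (mix w s).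
Proof.
move=> /generic_tuple_sub; apply=> [i|i j _ _ /(congr1 half)].
  exact: mix_lt.
by rewrite !half_bit_double.
Qed.

(* The points of the Cantor set index the mixtures of the two sequences; all
   mixtures are conjugate to the first sequence because each element is chosen
   to be generic over the previous ones and to fix the finite set on which the
   finitely many conjugating elements built so far are committed. *)
Lemma conjugate_mixtures (X Y : nat -> G -> Prop) :
    (forall n (A : seq V) D, comeager D -> exists u, [/\ X n u, fixes u A & D u]) ->
    (forall n (A : seq V) D, comeager D -> exists u, [/\ Y n u, fixes u A & D u]) ->
  exists (x y : nat -> G) (h : (nat -> bool) -> G),
    (forall n, X n (x n) /\ Y n (y n)) /\
    forall a n, h a * (if a n then y n else x n) = x n * h a.
Proof.
move=> XP YP.
(* At stage [n] each [h s] conjugates the first [n] entries exactly, on all of [V]; [F] is the list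
   on which later conjugators must agree with it. *)
pose P n (p : (nat -> G) * (seq bool -> G) * seq V) :=
  let: (w, h, F) := p in
  [/\ generic_tuple n.*2 w, forall i, i < n -> X i (w i.*2) /\ Y i (w i.*2.+1),
      good F /\ forall j, j < n.*2 -> stable (w j) F
    & forall s i, size s = n -> i < n -> h s * mix w s i = w i.*2 * h s].
pose R n (p q : (nat -> G) * (seq bool -> G) * seq V) :=
  let: (w, h, F) := p in let: (w', h', F') := q in
  [/\ forall j, j < n.*2 -> w' j = w j, {subset F <= F'}, en n \in F'
    & forall s b, size s = n -> {in F, act (h' (rcons s b)) =1 act (h s)} /\
        en n \in map (act (h' (rcons s b))) F'].
have [F0 [_ gF0 _]] := eppa [::].
have [|n [[w h] F] [gw XY [gF Fs] hc]|f [_ fP fR]] :=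
    @indexed_dependent_choice _ P R (fun=> 1, fun=> 1, F0).
- by split=> //; exact: generic_tuple0.
- pose words := [seq tval s | s : n.-tuple bool].
  have wordsP s : size s = n -> s \in words.
    by move=> /eqP sn; apply/mapP; exists (Tuple sn) => //; exact: mem_enum.
  have [F1 [FF1 gF1 F1s]] := gw.1
    (en n :: F ++ [seq (h s)^-1 \! en n | s <- words]).
  (* The new entries are taken to fix both [F1] and its images under the old conjugators. Hence each
     [h s] intertwines them trivially on [F1], and is a partial conjugation of length [n+1] from
     which [generic_conj] can start. *)
  pose L := F1 ++ flatten [seq map (act (h s)) F1 | s <- words].
  have F1L v : v \in F1 -> v \in L by move=> vF1; rewrite mem_cat vF1.
  have hF1L s v : size s = n -> v \in F1 -> h s \! v \in L.
    move=> sn vF1; rewrite mem_cat; apply/orP; right; apply/flatten_mapP.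
    by exists s; [exact: wordsP|exact: map_f].
  have [x [Xx xL gx]] := XP n L _ (generic_tuple_extend gw).
  have [y [Yy yL gy]] := YP n L _ (generic_tuple_extend gx).
  set w' := extend_tuple _ _ y in gy.
  have w'w j : j < n.*2 -> w' j = w j.
    by move=> ljn; rewrite /w' /extend_tuple (ltnW ljn : j < n.*2.+1) ljn.
  have w'x : w' n.*2 = x by rewrite /w' /extend_tuple ltnSn ltnn.
  have w'y : w' n.*2.+1 = y by rewrite /w' /extend_tuple ltnn.
  have mixw' s b i : size s = n -> i < n -> mix w' (rcons s b) i = mix w s i.
    by move=> sn lin; rewrite /mix nth_rcons sn lin w'w// mix_lt.
  have mixn s b : size s = n -> mix w' (rcons s b) n = if b then y else x.
    by move=> sn; rewrite /mix nth_rcons sn ltnn eqxx -w'x -w'y; case: b.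
  have zL (b : bool) : fixes (if b then y else x) L by case: b.
  have w'F1 j : j < n.+1.*2 -> stable (w' j) F1.
    rewrite doubleS ltnS leq_eqVlt => /orP[/eqP->|].
      by move=> v vF1; rewrite w'y yL// F1L.
    rewrite ltnS leq_eqVlt => /orP[/eqP-> v vF1|ljn].
      by rewrite w'x xL// F1L.
    by rewrite w'w//; exact: F1s.
  have /choice[h' h'P] : forall s, exists u, size s = n.+1 ->
      {in F1, act u =1 act (h (take n s))} /\
      forall i, i < n.+1 -> u * mix w' s i = w' i.*2 * u.
    case/lastP=> [|s b]; first by exists 1.
    have [sn|nsn] := eqVneq (size s) n; last first.
      by exists 1; rewrite size_rcons => -[/eqP]; rewrite (negbTE nsn).
    have [|u uF1 uP] := @generic_conj n.+1 (mix w' (rcons s b)) (mix w' [::]) (h s) F1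
        (generic_mix (n := n.+1) _ gy) (generic_mix (n := n.+1) _ gy).
      split=> // i lin; split; first exact/w'F1/mix_lt.
      move: lin; rewrite ltnS leq_eqVlt => /orP[/eqP->|lin] v vF1.
        rewrite mixn// /mix nth_nil w'x zL ?F1L// xL//; exact: hF1L.
      by rewrite mixw'// -actM hc// actM /mix nth_nil add0n w'w ?ltn_double.
    exists u => _; rewrite -cats1 take_size_cat//; split=> // i lin.
    by rewrite cats1 uP// /mix nth_nil.
  have F1w v : v \in F -> v \in F1.
    by move=> vF; apply: FF1; rewrite inE mem_cat vF !orbT.
  exists (w', h', F1); split; split=> //.
  + move=> i; rewrite ltnS leq_eqVlt => /orP[/eqP->|lin].
      by rewrite w'x w'y.
    rewrite !w'w; [exact: XY| |by rewrite ltn_double].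
    by rewrite -doubleS leq_double in lin *.
  + by move=> s i sn lin; exact: (h'P s sn).2.
  + by apply: FF1; rewrite inE eqxx.
  + move=> s b sn; have := h'P (rcons s b).
    rewrite size_rcons sn -cats1 take_size_cat// => -[//|hF1 _].
    split=> [v /F1w|]; first exact: hF1.
    apply/mapP; exists ((h s)^-1 \! en n).
      apply: FF1; rewrite inE mem_cat; apply/orP; right; apply/orP; right.
      exact/(map_f (fun s => (h s)^-1 \! en n))/wordsP.
    rewrite hF1 ?actVK//; apply: FF1; rewrite inE mem_cat.
    apply/orP; right; apply/orP; right.
    exact/(map_f (fun s => (h s)^-1 \! en n))/wordsP.
pose w n := (f n).1.1; pose h n := (f n).1.2; pose F n := (f n).2.
have {}fP n : P n (w n, h n, F n).
  by have := fP n; rewrite /w /h /F; case: (f n) => -[].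
have {}fR n : R n (w n, h n, F n) (w n.+1, h n.+1, F n.+1).
  have := fR n; rewrite /w /h /F; case: (f n) => -[? ?] ?.
  by case: (f n.+1) => -[? ?] ?.
have wE m n j : m <= n -> j < m.*2 -> w n j = w m j.
  move=> /subnK <- ljm; elim: (n - m)%N => [|k IHk]; first by rewrite add0n.
  have [wk _ _ _] := fR (k + m)%N; rewrite addSn wk//.
  by apply: leq_trans ljm _; rewrite leq_double leq_addl.
have FE m n : m <= n -> {subset F m <= F n}.
  move=> /subnK <-; elim: (n - m)%N => [|k IHk] v vF; first by rewrite add0n.
  by have [_ Fk _ _] := fR (k + m)%N; rewrite addSn; apply/Fk/IHk.
have /choice[ha haP] : forall a : nat -> bool, exists u, forall n,
    {in F n, act u =1 act (h n (mkseq a n))}.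
  move=> a; apply: act_limit => n; have [_ Fn eF hn] := fR n => //.
    by rewrite mkseqS; have [] := hn (mkseq a n) (a n) (size_mkseq _ _).
  by rewrite mkseqS; have [] := hn (mkseq a n) (a n) (size_mkseq _ _).
exists (fun n => w n.+1 n.*2), (fun n => w n.+1 n.*2.+1), ha; split=> [n|a n].
  by have [_ /(_ n (ltnSn n))] := fP n.+1.
apply: act_faithful => v; have [k <-] := en_surj v.
pose m := (maxn k n).+1.
have lnm : n < m by rewrite ltnS leq_maxr.
have vF : en k \in F m.
  by have [_ _ + _] := fR k; apply: FE; rewrite ltnS leq_maxl.
have [_ _ [_ Fs] /(_ (mkseq a m) n (size_mkseq _ _) lnm)] := fP m.
have := Fs _ (mix_lt (mkseq a m) lnm).
rewrite -/(mix (w m) (mkseq a m) n).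
have -> : mix (w m) (mkseq a m) n = if a n then w n.+1 n.*2.+1 else w n.+1 n.*2.
  by rewrite /mix nth_mkseq// -!(@wE n.+1 m)// ?doubleS//; case: (a n).
rewrite (@wE n.+1 m)// ?doubleS// => zs hz.
by rewrite actM (haP a m)// ?zs// -actM hz !actM (haP a m).
Qed.

(** * Small index and Bergman properties *)

Lemma fixesM g h (A : seq V) : fixes g A -> fixes h A -> fixes (g * h) A.
Proof. by move=> gA hA v vA; rewrite actM hA// gA. Qed.

Lemma fixesV g (A : seq V) : fixes g A -> fixes g^-1 A.
Proof. by move=> gA v vA; rewrite -[in LHS](gA v vA) actK. Qed.

(* Mycielski's theorem for the relation D (u^-1 * v). *)
Lemma cantor_scheme D (A : seq V) : comeager D ->
  exists u : (nat -> bool) -> G,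
    (forall a, fixes (u a) A) /\ forall a b, a <> b -> D ((u a)^-1 * u b).
Proof.
move=> [D' D'd D'D].
pose ok s t i (g : seq bool -> G) (F : seq V) := forall u v,
  {in F, act u =1 act (g s)} -> {in F, act v =1 act (g t)} -> D' i (u^-1 * v).
pose refines (g : seq bool -> G) (F : seq V) g' (F' : seq V) :=
  {subset F <= F'} /\ forall s, {in F, act (g' s) =1 act (g s)}.
have refine1 s t i g F : s != t -> exists g' F', refines g F g' F' /\ ok s t i g' F'.
  (* Only the branch [t] is changed, to [g s * k]. For [u^-1 * v] to act like [k] on [B], the value
     of [v] is needed on [B] and that of [u] on the image of [B] under [k], so both lists are
     frozen. *)
  move=> st; have [k [B [kF kB]]] := D'd i ((g s)^-1 * g t) F.
  exists (fun r => if r == t then g s * k else g r), (F ++ B ++ map (act k) B).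
  split; [split=> [v vF|r v vF]|]; first by rewrite mem_cat vF.
    by case: eqP => // ->; rewrite actM kF// actM actVK.
  move=> u v; rewrite eqxx (negbTE st) => ug vg; apply: kB => b bB.
  rewrite actM vg ?mem_cat ?bB ?orbT// actM.
  by rewrite -[in LHS](ug (k \! b)) ?actK// !mem_cat map_f ?orbT.
have refineW s t i g F g' F' : refines g F g' F' -> ok s t i g F -> ok s t i g' F'.
  move=> [FF' gg'] gok u v uE vE.
  have wF' w : w \in F -> w \in F' by exact: FF'.
  by apply: gok => w wF; rewrite ?(uE w (wF' w wF)) ?(vE w (wF' w wF)) gg'.
have refine_all (l : seq (seq bool * seq bool * nat)) g F :
    exists g' F', refines g F g' F' /\
      forall s t i, (s, t, i) \in l -> s != t -> ok s t i g' F'.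
  elim: l => [|[[s t] i] l [g1 [F1 [[FF1 gg1] IHl]]]].
    by exists g, F; split=> [|s t i]; [split|rewrite in_nil].
  have [->|st] := eqVneq s t.
    exists g1, F1; split=> // s' t' i'; rewrite inE => /orP[/eqP[-> -> _]|].
      by rewrite eqxx.
    exact: IHl.
  have [g2 [F2 [[F12 g12] ok2]]] := refine1 s t i g1 F1 st.
  exists g2, F2; split=> [|s' t' i'].
    split=> [v /FF1/F12//|r v vF]; by rewrite g12 ?gg1 ?FF1.
  rewrite inE => /orP[/eqP[-> -> ->]//|inl] st'.
  by apply: (@refineW _ _ _ g1 F1) => //; exact: IHl.
pose R n (p q : (seq bool -> G) * seq V) :=
  [/\ {subset p.2 <= q.2}, en n \in q.2,
    forall s b, size s = n -> {in p.2, act (q.1 (rcons s b)) =1 act (p.1 s)} /\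
      en n \in map (act (q.1 (rcons s b))) q.2
  & forall s t i, size s = n.+1 -> size t = n.+1 -> i <= n -> s != t ->
      ok s t i q.1 q.2].
have [//|n [g F] _|f [f0 _ fR]] :=
    @indexed_dependent_choice _ (fun _ _ => True) R (fun=> 1, A).
  pose words := [seq tval s | s : n.+1.-tuple bool].
  have wordsP s : size s = n.+1 -> s \in words.
    by move=> /eqP sn; apply/mapP; exists (Tuple sn) => //; exact: mem_enum.
  have [g' [F' [[FF' gg'] okl]]] := refine_all
    [seq (st, i) | st <- [seq (s, t) | s <- words, t <- words], i <- iota 0 n.+1]
    (fun s => g (take n s)) F.
  exists (g', en n :: F' ++ [seq (g' s)^-1 \! en n | s <- words]).
  split=> //; split=> [v /FF' vF'||s b sn|s t i sn tn lin st].
  - by rewrite inE mem_cat vF' !orbT.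
  - by rewrite inE eqxx.
  - split=> [v vF|].
      by rewrite gg'// -cats1 take_size_cat.
    apply/mapP; exists ((g' (rcons s b))^-1 \! en n); last by rewrite actVK.
    rewrite inE mem_cat (map_f (fun s => (g' s)^-1 \! en n)) ?orbT//.
    by apply: wordsP; rewrite size_rcons sn.
  - apply: (@refineW _ _ _ g' F'); last first.
      apply: okl => //; apply/allpairsP; exists ((s, t), i); split=> //.
        by apply/allpairsP; exists (s, t); split=> //=; exact: wordsP.
      by rewrite mem_iota.
    by split=> // v vF'; rewrite inE mem_cat vF' orbT.
have /choice[u uP] : forall a : nat -> bool, exists u, forall n,
    {in (f n).2, act u =1 act ((f n).1 (mkseq a n))}.
  move=> a; apply: act_limit => n; have [Fn eF hn _] := fR n => //.
    by rewrite mkseqS; have [] := hn (mkseq a n) (a n) (size_mkseq _ _).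
  by rewrite mkseqS; have [] := hn (mkseq a n) (a n) (size_mkseq _ _).
exists u; split=> [a v vA|a b ab].
  by rewrite (uP a 0) f0//= act1.
have [k abk] : exists k, a k <> b k.
  by apply/existsNP => ab'; apply: ab; exact/funext.
apply: D'D => i; set n := maxn k i; have [_ _ _ okn] := fR n.
apply: (okn (mkseq a n.+1) (mkseq b n.+1)); rewrite ?size_mkseq ?leq_maxr//;
  try exact: (uP _ n.+1).
apply/eqP => /(congr1 (fun s => nth false s k)).
by rewrite !nth_mkseq ?ltnS ?leq_maxl.
Qed.

Lemma subgroupP (H : set G) : is_subgroup H ->
  [/\ H 1, forall g h, H g -> H h -> H (g * h) & forall g, H g -> H g^-1].
Proof.
move=> Hs; split=> [|g h Hg Hh|g Hg].
- by have /set_mem := Hs.1.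
- by have := group_closedM Hs (mem_set Hg) (mem_set Hh); exact: set_mem.
- by have := group_closedV Hs (mem_set Hg); exact: set_mem.
Qed.

(** Otherwise the values of [u] would represent continuum many distinct left cosets. *)
Lemma small_index_pigeonhole (H : set G) (u : (nat -> bool) -> G) :
    is_subgroup H -> (left_cosets H #<= [set: set nat])%card ->
    ~~ (left_cosets H #= [set: set nat])%card ->
  exists a b, a <> b /\ H ((u a)^-1 * u b).
Proof.
move=> Hs le /negP ne; have [H1 HM HV] := subgroupP Hs.
apply: contrapT => noab; apply: ne; rewrite card_eq_le le /=.
pose F (X : set nat) : set G := [set u (fun n => `[< X n >]) * h | h in H]%classic.
have Finj : injective F.
  move=> X Y XY; apply: contrapT => nXY.
  have : F Y (u (fun n => `[< Y n >])) by exists 1; rewrite ?mulg1.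
  rewrite -XY => -[h Hh uh]; apply: noab.
  exists (fun n => `[< X n >]), (fun n => `[< Y n >]); split; last first.
    by rewrite -uh mulgA mulVg mul1g.
  move=> XYb; apply: nXY; apply/funext => n; have := congr1 (@^~ n) XYb.
  move=> /= XYn; apply/propext.
  by split=> /asboolP; [rewrite XYn|rewrite -XYn] => /asboolP.
have /card_eqPle[_ le'] := inj_card_eq (A := [set: set nat]%classic) (in2W Finj).
apply: (card_le_trans le'); apply: subset_card_le => _ [X _ <-].
by exists (u (fun n => `[< X n >])).
Qed.

Lemma small_index_open (H : set G) :
    is_subgroup H -> (left_cosets H #<= [set: set nat])%card ->
    ~~ (left_cosets H #= [set: set nat])%card ->
  exists A, forall g, fixes g A -> H g.
Proof.
move=> Hs le ne; have [H1 HM HV] := subgroupP Hs.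
apply: contrapT => noA.
have [n A D Dc|n A D Dc|x [y [h [XY hc]]]] :=
    @conjugate_mixtures (fun _ => H) (fun _ g => ~ H g).
(* Small index replaces non-meagerness: two members of a perfect family whose quotients lie in [D]
   share a coset of [H], so [H] meets [D] near the identity. *)
- have [u [uA uD]] := cantor_scheme A Dc.
  have [a [b [ab Hab]]] := small_index_pigeonhole u Hs le ne.
  exists ((u a)^-1 * u b); split=> //; last exact: uD.
  by apply: fixesM => //; exact: fixesV.
- have [v [vA Hv]] : exists v, fixes v A /\ ~ H v.
    apply: contrapT => nv; apply: noA; exists A => g gA.
    by apply: contrapT => Hg; apply: nv; exists g.
  (* For generic [u] both [u] and [u * v] lie in [D]; they cannot both lie in [H], as [v] does
     not. *)
  have [u [Du Duv] u1] :=
    baire 1 A (comeagerI Dc (comeager_translate v Dc)).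
  have uA : fixes u A by move=> w wA; rewrite u1// act1.
  have [Hu|] := pselect (H u); last by exists u.
  exists (u * v); split=> //; last exact: fixesM.
  move=> Huv; apply: Hv; rewrite -(mulKg u v).
  by apply: HM => //; exact: HV.
(* With [k] the quotient [(h a)^-1 * h b], the conjugation relations give [y n = k^-1 * x n * k], so
   [k] in [H] would put [y n] in [H]. *)
- have sep a b n : a n = false -> b n = true -> ~ H ((h a)^-1 * h b).
    move=> an bn Hab; have [Hx] := XY n; apply.
    have hx := hc a n; have hy := hc b n; rewrite an in hx; rewrite bn in hy.
    have hVx : (h a)^-1 * x n = x n * (h a)^-1.
      by apply: (mulgI (h a)); rewrite mulVKg mulgA hx mulgK.
    have -> : y n = ((h a)^-1 * h b)^-1 * (x n * ((h a)^-1 * h b)).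
      apply: (mulgI ((h a)^-1 * h b)).
      by rewrite mulVKg -mulgA hy (mulgA _ (x n)) hVx -mulgA.
    by apply: (HM); [exact: HV|exact: HM].
  have [a [b [ab Hab]]] := small_index_pigeonhole h Hs le ne.
  have [n abn] : exists n, a n <> b n.
    by apply/existsNP => ab'; apply: ab; exact/funext.
  case an: (a n) abn; case bn: (b n) => // _; last exact: (sep a b n).
  by apply: (sep b a n) => //; rewrite -[X in H X]invgK invgM invgK; exact: HV.
Qed.

Fixpoint products (k : nat) (W : G -> Prop) (g : G) : Prop :=
  if k is k'.+1 then exists w v, [/\ W w, products k' W v & g = w * v]
  else g = 1.

Lemma products1 W g : W g -> products 1 W g.
Proof. by move=> Wg; exists g, 1; rewrite mulg1. Qed.

Lemma productsM j k W g h :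
  products j W g -> products k W h -> products (j + k) W (g * h).
Proof.
elim: j g => [|j IHj] g /= => [->|[w [v [Ww jv ->]]] kh]; first by rewrite mul1g.
by exists w, (v * h); split=> //; [exact: IHj|rewrite mulgA].
Qed.

Lemma productsV k W g : (forall w, W w -> W w^-1) ->
  products k W g -> products k W g^-1.
Proof.
move=> WV; elim: k g => [|k IHk] g /= => [->|[w [v [Ww kv ->]]]].
  by rewrite invg1.
rewrite invgM; have := productsM (IHk _ kv) (products1 (WV _ Ww)).
by rewrite addn1.
Qed.

Lemma products_set_power k W (W' : set G) g : (forall w, W w -> W' w) ->
  products k W g -> set_power k W' g.
Proof.
move=> WW'; elim: k g => [|k IHk] g /= => [->|[w [v [Ww /IHk[u uW <-] ->]]]].
  by exists (fun=> 1); [case|rewrite big_ord0].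
exists (fun i : 'I_k.+1 => oapp u w (unlift ord0 i)) => [i|].
  by case: unliftP => [j _|_] /=; [exact: uW|exact: WW'].
rewrite big_ord_recl unlift_none; congr (_ * _).
by apply: eq_bigr => i _; rewrite liftK.
Qed.

Lemma comeager_translatel D h : comeager D -> comeager (fun g => D (h * g)).
Proof.
move=> [F Fd FD]; exists (fun i g => F i (h * g)) => [i g A|g gF]; last first.
  exact: FD.
have [g' [B [g'E g'F]]] := Fd i (h * g) A.
exists (h^-1 * g'), B; split=> [v vA|u uE].
  by rewrite actM g'E// actM actK.
by apply: g'F => v vB; rewrite actM uE// actM actVK.
Qed.

(** If quotients of [W n] close to the identity avoid a comeager [D], then on each of the countably
    many cosets of the stabilizer of [A] the set [W n] avoids a translate of [D], hence is meager.
    By Baire this cannot happen for every [n]. *)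
Lemma nonmeager_quotient (W : nat -> G -> Prop) : (forall g, exists n, W n g) ->
  exists n, forall (A : seq V) D, comeager D ->
    exists w v, [/\ W n w, W n v, fixes (w^-1 * v) A & D (w^-1 * v)].
Proof.
move=> Wcov; apply: contrapT => nW.
have {nW} nW n : exists p : seq V * (G -> Prop), comeager p.2 /\
    forall w v, W n w -> W n v -> fixes (w^-1 * v) p.1 -> ~ p.2 (w^-1 * v).
  apply: contrapT => nAD; apply: nW; exists n => A D Dc.
  apply: contrapT => nwv; apply: nAD; exists (A, D); split=> // w v Ww Wv wvA wvD.
  by apply: nwv; exists w, v.
have disjoint n : exists E, comeager E /\ forall u, W n u -> ~ E u.
  have [[A D] [/= Dc DW]] := nW n.
  have /choice[c cP] : forall t : seq nat, exists w,
      (exists u, W n u /\ map (act u) A = map en t) ->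
      W n w /\ map (act w) A = map en t.
    move=> t; have [[u uP]|nu] := pselect (exists u, W n u /\ map (act u) A = map en t).
      by exists u.
    by exists 1 => /nu.
  exists (fun u => forall t, D ((c t)^-1 * u)); split.
    by apply: comeager_all => t; exact: comeager_translatel.
  move=> u Wu uD.
  have [t tE] : exists t, map en t = map (act u) A.
    elim: (map _ A) => [|v B [t <-]]; first by exists [::].
    by have [k <-] := en_surj v; exists (k :: t).
  have [|Wc cE] := cP t; first by exists u.
  apply: (DW _ _ Wc Wu) (uD t) => v vA.
  have /eq_in_map cu : map (act (c t)) A = map (act u) A by rewrite cE.
  by rewrite actM -cu// actK.
have /choice[E EP] := disjoint.
have /(baire 1 [::])[u uE _] := comeager_all (fun n => (EP n).1).
by have [n Wn] := Wcov u; exact: (EP n).2 Wn (uE n).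
Qed.

(** Each pointwise stabilizer of a finite list has finitely many double cosets; in this form a bound
    on a stabilizer yields a bound on the group. *)
Hypothesis oligomorphic : forall A : seq V, exists F : seq G, forall g,
  exists f u v, [/\ f \in F, fixes u A, fixes v A & g = u * f * v].

(** The sets are first made symmetric. Quotients [w^-1 * v] supply each [x n] with 2 factors, and
    conjugating to [y n] adds one on either side, so [y n] must avoid 4 factors. A generic such
    [y n] is [u] or [u * v], which requires a [v] that is not a product of 4 + 4 factors; hence the
    8 for the stabilizer. *)
Lemma bergman_property21 : bergman_property G 21.
Proof.
move=> W Wmono Wcov.
have Wle m n g : m <= n -> W m g -> W n g.
  move=> /subnK <-; elim: (n - m)%N => [|k IHk] Wg; first by rewrite add0n.
  by rewrite addSn; exact/Wmono/IHk.
pose S n g := W n g /\ W n g^-1.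
have Sle m n g : m <= n -> S m g -> S n g.
  by move=> mn [Wg WVg]; split; exact: Wle mn _.
have SV n g : S n g -> S n g^-1 by move=> [Wg WVg]; split; rewrite ?invgK.
have Scov g : exists n, S n g.
  have inW h : exists n, W n h.
    by have : [set: G]%classic h by []; rewrite -Wcov => -[n _ Wh]; exists n.
  have [m Wm] := inW g; have [k Wk] := inW g^-1.
  exists (maxn m k); split; [apply: Wle Wm|apply: Wle Wk].
    exact: leq_maxl.
  exact: leq_maxr.
have [n0 n0P] := nonmeager_quotient Scov.
have [n [A nA]] : exists n (A : seq V), forall g, fixes g A -> products 8 (S n) g.
  apply: contrapT => nopen.
  have [n A D Dc|n A D Dc|x [y [h [XY hc]]]] := @conjugate_mixtures
      (fun n g => products 2 (S (n0 + n)%N) g) (fun n g => ~ products 4 (S (n0 + n)%N) g).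
  - have [w [v [Sw Sv wvA wvD]]] := n0P A D Dc.
    exists (w^-1 * v); split=> //; apply: (@productsM 1 1); apply: products1.
      by apply/SV/(Sle n0) => //; rewrite leq_addr.
    by apply: Sle Sv; rewrite leq_addr.
  - have [v [vA Sv]] : exists v, fixes v A /\ ~ products 8 (S (n0 + n)%N) v.
      apply: contrapT => nv; apply: nopen; exists (n0 + n)%N, A => g gA.
      by apply: contrapT => Sg; apply: nv; exists g.
    have [u [Du Duv] u1] :=
      baire 1 A (comeagerI Dc (comeager_translate v Dc)).
    have uA : fixes u A by move=> w wA; rewrite u1// act1.
    have [Su|] := pselect (products 4 (S (n0 + n)%N) u); last by exists u.
    exists (u * v); split=> //; first last.
      exact: fixesM.
    move=> Suv; apply: Sv; rewrite -(mulKg u v).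
    apply: (@productsM 4 4) => //; apply: productsV => //; exact: SV.
  (* The constant mixture conjugates all of [y] to all of [x] at once; the index [m] is chosen only
     after its conjugator is known. *)
  - have [m Sm] := Scov (h xpredT).
    have [+ ySm] := XY m; have := hc xpredT m => /= hm Sx; apply: ySm.
    have {}Sm : S (n0 + m)%N (h xpredT) by apply: Sle Sm; rewrite leq_addl.
    rewrite -(mulKg (h xpredT) (y m)) hm; apply: (@productsM 1 3).
      exact/products1/SV.
    by apply: (@productsM 2 1) => //; exact: products1.
have [F FP] := oligomorphic A.
have [m [nm mF]] : exists m, n <= m /\ forall f, f \in 1 :: F -> S m f.
  elim: (1 :: F) => [|f F' [m [nm mF]]]; first by exists n.
  have [k Sk] := Scov f; exists (maxn k m); split.
    by rewrite (leq_trans nm)// leq_maxr.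
  move=> g; rewrite inE => /orP[/eqP->|/mF].
    by apply: Sle Sk; rewrite leq_maxl.
  by apply: Sle; rewrite leq_maxr.
have Spow k g : products k (S n) g -> products k (S m) g.
  elim: k g => // k IHk g [w [v [Sw kv ->]]].
  by exists w, v; split=> //; [exact: Sle Sw|exact: IHk].
have {}nA g : fixes g A -> products 8 (S m) g by move=> /nA/Spow.
have S1 : products 1 (S m) 1 by apply/products1/mF; rewrite inE eqxx.
exists m; apply/seteqP; split=> // g _.
apply: (@products_set_power _ (S m)); first by move=> w [].
have [f [u [v [fF uA vA ->]]]] := FP g.
rewrite -(mulg1 (u * f * v)) -(mulg1 1) -(mulg1 (1 * 1)) -(mulg1 (1 * 1 * 1)).
(* 8 + 1 + 8 factors suffice, and the remaining four are trivial. *)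
apply: (@productsM 17 4); last first.
  apply: (@productsM 3 1) => //; apply: (@productsM 2 1) => //.
  exact: (@productsM 1 1).
apply: (@productsM 9 8); last exact: nA.
apply: (@productsM 8 1); first exact: nA.
by apply/products1/mF; rewrite inE fF orbT.
Qed.

End PermutationGroup.

(** * Extending partial automorphisms of multipartite tournaments *)

Definition same_part (T : Type) (e : rel T) : rel T :=
  fun x y => ~~ e x y && ~~ e y x.

(** Transitivity of non-adjacency recovers the parts from the edges alone, so every isomorphism
    preserves them. *)
Definition multipartite (T : Type) (e : rel T) : Prop :=
  [/\ irreflexive e, forall x y, e x y -> ~~ e y x & transitive (same_part e)].

(** Evenness modulo 2: the rows of two vertices of one part differ by a constant on every part. *)
Definition even_parity (T : Type) (e : rel T) : Prop :=
  forall x x' y y', same_part e x x' -> same_part e y y' ->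
    e x y (+) e x y' = e x' y (+) e x' y'.

Definition tournament_class (sg : bool) (T : Type) (e : rel T) : Prop :=
  multipartite e /\ (sg -> even_parity e).

Section SamePart.
Variables (T : Type) (e : rel T).
Hypothesis me : multipartite e.

Lemma same_part_refl x : same_part e x x.
Proof. by case: me => irr _ _; rewrite /same_part irr. Qed.

Lemma same_part_sym x y : same_part e x y = same_part e y x.
Proof. by rewrite /same_part andbC. Qed.

Lemma same_part_trans : transitive (same_part e).
Proof. by case: me. Qed.

Lemma same_part_left x y : same_part e x y -> same_part e x =1 same_part e y.
Proof.
move=> xy z; apply/idP/idP; last exact: same_part_trans.
by apply: same_part_trans; rewrite same_part_sym.
Qed.

Lemma same_part_edge x y : same_part e x y -> e x y = false.
Proof. by move=> /andP[/negbTE]. Qed.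

Lemma edge_sym x y : ~~ same_part e x y -> e x y = ~~ e y x.
Proof.
case: me => _ asym _; rewrite /same_part negb_and !negbK.
by case: (e x y) (asym x y) => [->|_ /= ->].
Qed.

End SamePart.

Lemma directed_graph_asym (T : eqType) (e : rel T) :
  directed_graph e <-> irreflexive e /\ (forall x y, e x y -> ~~ e y x).
Proof.
split=> [[irr anti]|[irr asym]]; split=> // x y.
  move=> exy; apply/negP => eyx; have xy : x = y by apply: anti; rewrite exy.
  by rewrite xy irr in exy.
by move=> /andP[/asym/negbTE->].
Qed.

Lemma tournament_parts_same_part (T : Type) (e : rel T) part :
    irreflexive e -> (forall x y, e x y -> ~~ e y x) ->
  tournament_parts e part <-> forall x y, same_part e x y = (part x == part y).
Proof.
move=> irr asym; split=> [ep x y|ep x y].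
  have := ep y x; have := ep x y; rewrite eq_sym /same_part.
  by case: eqP => _; case: (e x y) (e y x) => -[].
have := asym x y; rewrite -ep /same_part.
by case: (e x y); case: (e y x) => //= /(_ isT).
Qed.

Lemma multipartite_parts (T : finType) (e : rel T) :
  multipartite e <-> directed_graph e /\ exists part, tournament_parts e part.
Proof.
split=> [me|[/directed_graph_asym[irr asym] [part]]]; last first.
  move=> /(tournament_parts_same_part part irr asym) ep; split=> // y x z.
  by rewrite !ep => /eqP->.
have [irr asym _] := me; split; first exact/directed_graph_asym.
(* A part is named by the rank of its picked member; the default 0 never occurs, since [x] lies in
   its own part. *)
exists (fun x => if [pick y | same_part e x y] is Some y then enum_rank y : nat else 0).
apply/tournament_parts_same_part => // x y; apply/idP/eqP => [xy|].
  by congr (if _ is Some _ then _ else _); apply: eq_pick; exact: same_part_left.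
case: pickP => [a xa|/(_ x)]; last by rewrite same_part_refl.
case: pickP => [b yb|/(_ y)]; last by rewrite same_part_refl.
move=> /ord_inj/enum_rank_inj ab; rewrite -ab in yb.
by apply: same_part_trans xa _ => //; rewrite same_part_sym.
Qed.

Lemma tournament_classP (sg : bool) (T : finType) (e : rel T) :
  tournament_class sg e <->
  if sg then semigeneric_tournament e else omega_partite_tournament e.
Proof.
case: sg; last first.
  split=> [[/multipartite_parts]//|/multipartite_parts me]; by split.
split=> [[me /(_ isT) ev]|[dg [part [ep ev]]]].
  have [dg [part ep]] := (multipartite_parts e).1 me.
  have [irr asym _] := me; split=> //; exists part; split=> // a b c d ab _ cd _.
  have sp := (tournament_parts_same_part part irr asym).1 ep.
  have := ev a b c d; rewrite !sp ab cd !eqxx => /(_ isT isT).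
  by rewrite !oddD !oddb; do 4!case: (e _ _).
have me : multipartite e by apply/multipartite_parts; split=> //; exists part.
split=> // _ a b c d; have [irr asym _] := me.
rewrite !((tournament_parts_same_part part irr asym).1 ep) => /eqP ab /eqP cd.
have [<-//|/eqP nab] := eqVneq a b.
have [<-|/eqP ncd] := eqVneq c d; first by rewrite !addbb.
by have := ev a b c d ab nab cd ncd; rewrite !oddD !oddb; do 4!case: (e _ _).
Qed.

Lemma multipartite_relation (T : Type) (sp w : rel T) :
    reflexive sp -> symmetric sp -> transitive sp ->
    (forall x y, ~~ sp x y -> w x y = ~~ w y x) ->
  let e x y := ~~ sp x y && w x y in
  multipartite e /\ same_part e =2 sp.
Proof.
move=> refl sym tr asym e.
have eE : same_part e =2 sp.
  move=> x y; rewrite /same_part /e (sym y).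
  by case: (boolP (sp x y)) => //= /asym->; case: (w y x).
split=> //; split=> [x|x y|y x z].
- by rewrite /e refl.
- by rewrite /e (sym y) => /andP[nxy]; rewrite nxy /= asym.
- by rewrite !eE; exact: tr.
Qed.

Lemma perm_extension (I W : finType) (x y : I -> W) (S : pred I) :
    {in S &, forall i j, (x i == x j) = (y i == y j)} ->
  exists s : {perm W}, {in S, forall i, s (x i) = y i}.
Proof.
move=> xy; suff [s sP] : exists s : {perm W}, forall i, i \in enum S -> s (x i) = y i.
  by exists s => i iS; apply: sP; rewrite mem_enum.
have : {subset enum S <= S} by move=> i; rewrite mem_enum.
elim: (enum S) => [_|i l IHl lS]; first by exists 1%g.
have [j jl|s sP] := IHl; first by apply: lS; rewrite inE jl orbT.
have iS : i \in S by apply: lS; rewrite inE eqxx.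
(* The transposition corrects the value at [x i] and leaves the earlier values alone, as those
   differ from both swapped points. *)
exists (s * tperm (s (x i)) (y i))%g => j; rewrite inE permM.
have [->|_ /= jl] := eqVneq j i; first by rewrite tpermL.
have jS : j \in S by apply: lS; rewrite inE jl orbT.
have [xji|xji] := eqVneq (x j) (x i).
  by rewrite xji tpermL; apply/eqP; rewrite -xy// xji.
rewrite tpermD; [exact: sP|by rewrite (inj_eq perm_inj) eq_sym|].
by rewrite sP// eq_sym -xy.
Qed.

Lemma enum_rank_asym (W : finType) (v w : W) : v != w ->
  (enum_rank v < enum_rank w) = ~~ (enum_rank w < enum_rank v).
Proof.
by move=> vw; rewrite -leqNgt ltn_neqAle (inj_eq val_inj) (inj_eq enum_rank_inj) vw.
Qed.

(* A vertex over v carries a colouring of the other base points, and the edge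
   between vertices over v and w is read off their two relevant colours. Hence a
   permutation g of the base lifts to an automorphism: a mismatch between c v w
   and c (g v) (g w) is repaired by flipping the colour of w in all vertices over
   v, or the colour of v in all vertices over w. *)
Section ValuationGraph.
Variables (W : finType) (q c : rel W).
Hypothesis q_refl : reflexive q.
Hypothesis q_sym : symmetric q.
Hypothesis q_trans : transitive q.
Hypothesis c_asym : forall v w, ~~ q v w -> c v w = ~~ c w v.

(** The colour of the base point of [x] itself is never read by an edge. Setting it to false lets
    the edges determine the vertex within its part when every part lies over a single base point. *)
Definition valuation := {x : W * {ffun W -> bool} | ~~ x.2 x.1}.

Definition valuation_edge : rel valuation := fun x y =>
  ~~ q (val x).1 (val y).1 &&
  ((val x).2 (val y).1 (+) (val y).2 (val x).1 (+) c (val x).1 (val y).1).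

Let valuation_relation : multipartite valuation_edge /\
  same_part valuation_edge =2 fun x y : valuation => q (val x).1 (val y).1.
Proof.
apply: multipartite_relation => [x|x y|y x z|x y /c_asym->].
- exact: q_refl.
- exact: q_sym.
- exact: q_trans.
- by case: ((val x).2 _); case: ((val y).2 _); case: (c _ _).
Qed.

Lemma valuation_same_part (x y : valuation) :
  same_part valuation_edge x y = q (val x).1 (val y).1.
Proof. exact: valuation_relation.2. Qed.

Lemma valuation_multipartite : multipartite valuation_edge.
Proof. exact: valuation_relation.1. Qed.

Lemma valuation_automorphism (g : {perm W}) (D : pred W) (t : rel W) :
    (forall v w, q (g v) (g w) = q v w) ->
    {in D, forall v, t v v = false} ->
    {in D &, forall v w, ~~ q v w ->
       t v w (+) t w v = c v w (+) c (g v) (g w)} ->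
  exists h : valuation -> valuation, [/\ injective h,
    forall x y, valuation_edge (h x) (h y) = valuation_edge x y
    & forall x, (val x).1 \in D -> (val (h x)).1 = g (val x).1 /\
        forall w, (val (h x)).2 (g w) = (val x).2 w (+) t (val x).1 w].
Proof.
move=> gq tD tDD.
pose d v w := c v w (+) c (g v) (g w).
have d_sym v w : ~~ q v w -> d v w = d w v.
  move=> nq; rewrite /d c_asym// (@c_asym (g v)) ?gq//.
  by case: (c _ _); case: (c _ _).
(* [s v w] tells whether vertices over [v] flip the colour of [w]; the two flips of a pair must add
   up to the mismatch [d]. Off [D] the whole flip is charged to the endpoint of smaller rank. *)
pose s v w := if v \in D then t v w else if w \in D then d v w (+) t w v
  else (enum_rank v < enum_rank w) && d v w.
have sP v w : ~~ q v w -> s v w (+) s w v = d v w.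
  move=> nq; rewrite /s; case: ifP => vD; case: ifP => wD.
  - exact: tDD.
  - by rewrite -(d_sym v w)// addbC -addbA addbb addbF.
  - by rewrite -addbA addbb addbF.
  - have vw : v != w by apply: contra nq => /eqP->; exact: q_refl.
    by rewrite -(d_sym v w)// (enum_rank_asym vw); case: (_ < _) (d v w) => -[].
have svv v : s v v = false.
  by rewrite /s; case: (boolP (v \in D)) => [/tD|_] //; rewrite ltnn.
pose h0 (x : valuation) : W * {ffun W -> bool} := (g (val x).1,
  [ffun w => (val x).2 (g^-1%g w) (+) s (val x).1 (g^-1%g w)]).
have hP x : ~~ (h0 x).2 (h0 x).1.
  by rewrite ffunE permK svv addbF; exact: (valP x).
pose h x : valuation := exist _ (h0 x) (hP x).
exists h; split=> [x y hxy|x y|x xD].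
- have /(congr1 fst)/= /perm_inj xy1 := congr1 val hxy.
  have /(congr1 snd)/= /ffunP xy2 := congr1 val hxy.
  apply: val_inj; rewrite [LHS]surjective_pairing [RHS]surjective_pairing xy1.
  congr pair; apply/ffunP => w; have := xy2 (g w).
  by rewrite !ffunE permK xy1 => /addIb.
- rewrite /valuation_edge /= gq !ffunE !permK; case: (boolP (q _ _)) => //= nq.
  have := sP _ _ nq; rewrite /d.
  by do 2!case: (s _ _); do 2!case: (c _ _); case: ((val x).2 _); case: ((val y).2 _).
- by split=> //= w; rewrite ffunE permK /s xD.
Qed.

End ValuationGraph.

(** This becomes goodness once the witness sits inside the limit: a vertex of the limit in the part
    of [b] cuts out a row [z] on the witness, and [b'] is its twin. *)
Definition saturated (B : finType) (e : rel B) : Prop :=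
  (forall b (z : pred B), (forall d, same_part e b d -> z d = false) ->
     (forall d d', same_part e d d' -> z d (+) z d' = e b d (+) e b d') ->
     exists b', same_part e b b' /\ z =1 e b') /\
  (forall b b', same_part e b b' -> e b =1 e b' -> b = b').

Definition eppa_witness (sg : bool) (A : finType) (e : rel A) (B : finType)
    (eB : rel B) (f : A -> B) : Prop :=
  [/\ tournament_class sg eB, injective f,
    forall x y, eB (f x) (f y) = e x y,
    forall (S : pred A) (p : A -> A), {in S &, injective p} ->
      {in S &, forall x y, e (p x) (p y) = e x y} ->
      exists h : B -> B, [/\ injective h, forall x y, eB (h x) (h y) = eB x y
        & {in S, forall x, h (f x) = f (p x)}]
  & sg -> saturated eB].

Section PartRepresentative.
Variables (A : finType) (e : rel A).
Hypothesis me : multipartite e.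

Definition part_rep x := odflt x [pick y | same_part e x y].

Lemma part_rep_same x : same_part e x (part_rep x).
Proof.
by rewrite /part_rep; case: pickP => [//|_] /=; exact: same_part_refl.
Qed.

Lemma part_repP x y : (part_rep x == part_rep y) = same_part e x y.
Proof.
apply/eqP/idP => [xy|xy].
  apply: same_part_trans (part_rep_same x) _ => //.
  by rewrite xy same_part_sym part_rep_same.
rewrite /part_rep (eq_pick (same_part_left me xy)).
by case: pickP => // /(_ y); rewrite same_part_refl.
Qed.

Lemma same_part_rep x y : same_part e (part_rep x) (part_rep y) = same_part e x y.
Proof.
rewrite -(same_part_left me (part_rep_same x)) same_part_sym.
by rewrite -(same_part_left me (part_rep_same y)) same_part_sym.
Qed.

Lemma part_rep_permutation (S : pred A) (p : A -> A) :
    {in S &, forall x y, e (p x) (p y) = e x y} ->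
  exists t : {perm A}, {in S, forall x, t (part_rep x) = part_rep (p x)}.
Proof.
move=> pe; apply: (@perm_extension _ _ part_rep (part_rep \o p)) => x y xS yS.
by rewrite /= !part_repP /same_part !pe.
Qed.

Lemma partial_permutation (S : pred A) (p : A -> A) : {in S &, injective p} ->
  exists s : {perm A}, {in S, forall x, s x = p x}.
Proof.
move=> pI; apply: (@perm_extension _ _ id p) => x y xS yS /=.
by apply/eqP/eqP => [->//|]; exact: pI.
Qed.

End PartRepresentative.

(** Base points pair a part with a vertex because a permutation of [A] extending [p] need not
    respect parts; permuting the coordinates separately preserves [q]. As [c] copies the edges of
    [A], all-false colourings embed [A], and no flips are prescribed over the domain of [p]. *)
Lemma eppa_omega_partite (A : finType) (e : rel A) : multipartite e ->
  exists (B : finType) (eB : rel B) (f : A -> B), eppa_witness false e eB f.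
Proof.
move=> me.
pose W : finType := (A * A)%type.
pose q : rel W := fun v w => v.1 == w.1.
pose c : rel W := fun v w =>
  if same_part e v.2 w.2 then enum_rank v < enum_rank w else e v.2 w.2.
have q_refl : reflexive q by move=> v; exact: eqxx.
have q_sym : symmetric q by move=> v w; exact: eq_sym.
have q_trans : transitive q by move=> w v u /eqP vw; rewrite /q vw.
have c_asym v w : ~~ q v w -> c v w = ~~ c w v.
  move=> nq; rewrite /c (same_part_sym _ w.2); case: ifP => [_|/negbT].
    by apply: enum_rank_asym; apply: contra nq => /eqP->; exact: q_refl.
  exact: edge_sym.
pose base x : W := (part_rep e x, x).
have base_q x y : q (base x) (base y) = same_part e x y by exact: part_repP.
have base_c x y : ~~ same_part e x y -> c (base x) (base y) = e x y.
  by rewrite /c /= => /negbTE->.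
have fP x : ~~ ([ffun=> false] : {ffun W -> bool}) (base x) by rewrite ffunE.
pose f x : valuation W := exist _ (base x, [ffun=> false]) (fP x).
exists (valuation W), (valuation_edge q c), f; split=> //.
- by split=> //; exact: valuation_multipartite.
- by move=> x y /(congr1 val)/(congr1 fst)/(congr1 snd).
- move=> x y; rewrite /valuation_edge /= !ffunE /= base_q.
  by case: (boolP (same_part e x y)) => [sxy|nxy] /=;
    [rewrite same_part_edge|rewrite base_c].
move=> S p pI pe.
have [s sP] := partial_permutation pI; have [t tP] := part_rep_permutation me pe.
have gI : injective (fun v : W => (t v.1, s v.2) : W).
  by move=> [v1 v2] [w1 w2] /= [/perm_inj-> /perm_inj->].
pose g := perm gI.
have gE x : x \in S -> g (base x) = base (p x).
  by move=> xS; rewrite permE /= tP// sP.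
have [v w|//||h [hI he hP]] := valuation_automorphism q_refl c_asym
    (g := g) (D := [pred v | [exists x in S, v == base x]]) (t := fun _ _ => false).
- by rewrite /q !permE /= (inj_eq perm_inj).
- move=> _ _ /exists_inP[x xS /eqP->] /exists_inP[y yS /eqP->].
  rewrite base_q => nxy; rewrite !gE// !base_c ?pe ?addbb//.
  by rewrite /same_part !pe.
exists h; split=> // x xS; have [|h1 h2] := hP (f x).
  by apply/exists_inP; exists x.
apply: val_inj; rewrite [LHS]surjective_pairing h1 /= gE//; congr pair.
by apply/ffunP => w; have := h2 (g^-1%g w); rewrite permKV !ffunE.
Qed.

(** By parity an edge is the sum of the edges from each representative to the other vertex and of
    one edge between representatives, which is the shape of a valuation edge. With one base point
    per part, parity of the witness is automatic: an edge is a term in [x] plus a term in [y] plus a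
    constant. *)
Lemma eppa_semigeneric (A : finType) (e : rel A) : tournament_class true e ->
  exists (B : finType) (eB : rel B) (f : A -> B), eppa_witness true e eB f.
Proof.
move=> [me /(_ isT) ev].
pose r := part_rep e.
have edge_rep x y : ~~ same_part e x y ->
    e x y = e (r x) y (+) e (r y) x (+) e (r y) (r x).
  move=> nxy; have sx := part_rep_same me x; have sy := part_rep_same me y.
  have := ev _ _ _ _ sx sy; rewrite -/(r x) -/(r y).
  have -> : e x (r y) = ~~ e (r y) x.
    apply: edge_sym => //; rewrite same_part_sym -(same_part_left me sy).
    by rewrite same_part_sym.
  have -> : e (r x) (r y) = ~~ e (r y) (r x).
    by apply: edge_sym => //; rewrite same_part_rep.
  by case: (e x y); case: (e (r y) x); case: (e (r x) y); case: (e _ _).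
have rep_edge x : e (r x) x = false.
  by apply: same_part_edge; rewrite same_part_sym part_rep_same.
(* A base point (i, K) is a potential part of the witness, K x being the colour
   of the vertex x of A relative to it. *)
pose W : finType := (A * {ffun A -> bool})%type.
pose q : rel W := fun v w => v == w.
pose c : rel W := fun v w =>
  if same_part e v.1 w.1 then enum_rank v < enum_rank w else e w.1 v.1.
have q_refl : reflexive q by move=> v; exact: eqxx.
have q_sym : symmetric q by move=> v w; exact: eq_sym.
have q_trans : transitive q by move=> w v u /eqP->.
have c_asym v w : ~~ q v w -> c v w = ~~ c w v.
  move=> nq; rewrite /c (same_part_sym _ w.1); case: ifP => [_|/negbT].
    exact: enum_rank_asym.
  by rewrite same_part_sym => ?; exact: edge_sym.
pose base x : W := (r x, [ffun y => e (r x) y]).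
have base_q x y : q (base x) (base y) = same_part e x y.
  rewrite -(part_repP me); apply/eqP/eqP => [[]//|xy].
  by rewrite /base /r xy.
have base_c x y : ~~ same_part e x y -> c (base x) (base y) = e (r y) (r x).
  by rewrite /c /= same_part_rep// => /negbTE->.
have fP x : ~~ ([ffun w : W => (w != base x) && w.2 x] : {ffun W -> bool}) (base x).
  by rewrite ffunE eqxx.
pose f x : valuation W := exist _ (base x, _) (fP x).
exists (valuation W), (valuation_edge q c), f; split.
- split=> [|_ x x' y y']; first exact: valuation_multipartite.
  rewrite !valuation_same_part// => /eqP xx' /eqP yy'.
  rewrite /valuation_edge -xx' -yy'; case: (q _ _) => //=.
  case: ((val x).2 _); case: ((val x').2 _); case: ((val y).2 _);
    by case: ((val y').2 _); case: (c _ _).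
- move=> x y xy; apply/eqP; apply: contraT => nxy.
  have bxy : base x = base y := congr1 (fst \o val) xy.
  (* Vertices of one part share their base point; the base point carrying the indicator function of
     [x] tells them apart. *)
  have /ffunP/(_ (r x, [ffun z => z == x])) := congr1 (snd \o val) xy.
  rewrite /= !ffunE /= ?ffunE eqxx andbT (eq_sym y) (negbTE nxy) andbF => /negbFE.
  by move=> /eqP[] /ffunP/(_ x); rewrite !ffunE eqxx rep_edge.
- move=> x y; rewrite /valuation_edge /= base_q.
  case: (boolP (same_part e x y)) => [sxy|nxy] /=; first by rewrite same_part_edge.
  rewrite !ffunE /= ?ffunE base_c// -!/(q _ _) !base_q (same_part_sym _ y).
  by rewrite nxy (edge_rep _ _ nxy) /=; congr (_ (+) _); exact: addbC.
- move=> S p pI pe.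
  have pS : {in S &, forall x y, same_part e (p x) (p y) = same_part e x y}.
    by move=> x y xS yS; rewrite /same_part !pe.
  have [s sP] := partial_permutation pI; have [t tP] := part_rep_permutation me pe.
  (* The correction to the colour of [x] under which the lifted permutation sends [base y] to
     [base (p y)] for [y] in [S]. *)
  pose flip j x := [exists y in S, j == r y] && (e j x (+) e (t j) (s x)).
  have flip_rep y x : y \in S -> flip (r y) x = e (r y) x (+) e (r (p y)) (s x).
    move=> yS; rewrite /flip tP//.
    by have -> : [exists z in S, r y == r z] by apply/exists_inP; exists y.
  have flip_const j x x' : x \in S -> x' \in S -> same_part e x x' ->
      flip j x = flip j x'.
    move=> xS x'S xx'; rewrite /flip; case: exists_inP => // -[y yS /eqP->] /=.
    rewrite tP// !sP//.
    have E z : e (r z) x (+) e (r z) x' = e z x (+) e z x'.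
      by apply: ev => //; rewrite same_part_sym part_rep_same.
    have E' z : e (r z) (p x) (+) e (r z) (p x') = e z (p x) (+) e z (p x').
      by apply: ev; rewrite ?pS// same_part_sym part_rep_same.
    have := E y; have := E' (p y); rewrite !pe//.
    case: (e y x); case: (e y x'); case: (e (r y) x); case: (e (r y) x');
      by case: (e (r (p y)) (p x)); case: (e (r (p y)) (p x')).
  have gI : injective (fun v : W => (t v.1, [ffun x => v.2 (s^-1%g x) (+)
      flip v.1 (s^-1%g x)]) : W).
    move=> [v1 v2] [w1 w2] /= [/perm_inj-> /ffunP vw]; congr pair.
    by apply/ffunP => x; have := vw (s x); rewrite !ffunE permK => /addIb.
  pose g := perm gI.
  have gE x : x \in S -> g (base x) = base (p x).
    move=> xS; rewrite permE /base /= tP//; congr pair; apply/ffunP => y.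
    by rewrite !ffunE flip_rep// permKV addbA addbb addFb.
  (* Vertices with the same base point form one part, and by [flip_const] the choice among those in
     [S] is immaterial. *)
  pose T v (w : W) := if [pick x in S | v == base x] is Some x then flip w.1 x else false.
  have TE x w : x \in S -> T (base x) w = flip w.1 x.
    move=> xS; rewrite /T; case: pickP => [y /andP[yS xy]|/(_ x)]; last first.
      by rewrite /= xS eqxx.
    by apply: flip_const => //; rewrite -base_q q_sym.
  have [v w|_ /exists_inP[x xS /eqP->]||h [hI he hP]] :=
      valuation_automorphism q_refl c_asym (g := g)
      (D := [pred v | [exists x in S, v == base x]]) (t := T).
  + by rewrite /q (inj_eq perm_inj).
  + by rewrite TE//= flip_rep// sP// !rep_edge.
  + move=> _ _ /exists_inP[x xS /eqP->] /exists_inP[y yS /eqP->].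
    rewrite base_q => nxy; rewrite !TE//= !flip_rep// !sP// !gE// !base_c ?pS//.
    have := edge_rep _ _ nxy; have := edge_rep (p x) (p y).
    rewrite pS// pe// => /(_ nxy)->.
    case: (e (r x) y); case: (e (r y) x); case: (e (r y) (r x)) => /=;
      by case: (e (r (p x)) _); case: (e (r (p y)) (p x)); case: (e (r (p y)) _).
  exists h; split=> // x xS; have [|h1 h2] := hP (f x).
    by apply/exists_inP; exists x.
  apply: val_inj; rewrite [LHS]surjective_pairing h1 /= gE//; congr pair.
  apply/ffunP => w'; have := h2 (g^-1%g w'); rewrite permKV => ->.
  set w := (g^-1)%g w'; have -> : w' = g w by rewrite permKV.
  rewrite /= !ffunE -gE// (inj_eq perm_inj) TE//.
  have -> : (g w).2 (p x) = w.2 x (+) flip w.1 x.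
    by rewrite permE /= ffunE -sP// permK.
  have [->|//] := eqVneq w (base x); by rewrite /= flip_rep// sP// !rep_edge.
- move=> _; split=> [b z zb zpar|b b' bb' e_bb'].
  (* The row is read off at one vertex over each base point, the all-false one; parity then
     determines it on the rest of that part. *)
  + pose zero_at w : valuation W := insubd b (w, [ffun=> false]).
    have zeroE w : val (zero_at w) = (w, [ffun=> false]).
      by rewrite val_insubd /= ffunE.
    set v := (val b).1.
    have chiP : ~~ ([ffun w : W => (w != v) && (z (zero_at w) (+) c v w)] :
        {ffun W -> bool}) v.
      by rewrite ffunE eqxx.
    pose b' : valuation W := exist _ (v, _) chiP.
    have bb' : same_part (valuation_edge q c) b b' by rewrite valuation_same_part.
    exists b'; split=> // d.
    have [vd|vd] := boolP (same_part (valuation_edge q c) b d).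
      rewrite zb// same_part_edge// -(same_part_left _ bb')//.
      exact: valuation_multipartite.
    have qvd : ~~ q v (val d).1 by rewrite valuation_same_part in vd.
    have dd : same_part (valuation_edge q c) d (zero_at (val d).1).
      by rewrite valuation_same_part// zeroE.
    have := zpar _ _ dd; rewrite /valuation_edge /= !zeroE /= -/v qvd /= !ffunE.
    rewrite (eq_sym _ v) qvd /= /v.
    by case: (z d); case: (z _); case: ((val b).2 _); case: ((val d).2 _); case: (c _ _).
  + apply: val_inj; rewrite [LHS]surjective_pairing [RHS]surjective_pairing.
    move: (bb'); rewrite valuation_same_part// => /eqP b1.
    rewrite -b1; congr pair; apply/ffunP => w.
    have [->|wb] := eqVneq w (val b).1.
      by rewrite (negbTE (valP b)) b1 (negbTE (valP b')).
    pose d : valuation W := insubd b (w, [ffun=> false]).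
    have dE : val d = (w, [ffun=> false]) by rewrite val_insubd /= ffunE.
    have := e_bb' d; rewrite /valuation_edge dE /= !ffunE -b1 /q eq_sym wb /=.
    by rewrite !addbF => /addIb.
Qed.

Lemma tournament_eppa sg (A : finType) (e : rel A) : tournament_class sg e ->
  exists (B : finType) (eB : rel B) (f : A -> B), eppa_witness sg e eB f.
Proof.
by case: sg => [|[]]; [exact: eppa_semigeneric|move=> ? _; exact: eppa_omega_partite].
Qed.

(** * Amalgamation *)

Lemma tournament_class_relpre sg (T U : Type) (f : T -> U) (e : rel U) :
  tournament_class sg e -> tournament_class sg (relpre f e).
Proof.
move=> [[irr asym tr] ev]; split.
  by split=> [x|x y|y x z]; [exact: irr|exact: asym|exact: tr].
by move=> /ev{}ev x x' y y'; exact: ev.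
Qed.

Section Amalgam.
Variables (V : choiceType) (E : rel V) (sg : bool) (A : seq V).
Hypothesis EC : tournament_class sg E.

Let ME : multipartite E := EC.1.

Let same_refl := same_part_refl ME.
Let same_trans := same_part_trans ME.

(* Every vertex in a part meeting A has a unique twin over A in that part, so
   the parts meeting A retract onto A equivariantly. *)
Definition good_seq : Prop := sg ->
  (forall u a, a \in A -> same_part E u a ->
     exists a', [/\ a' \in A, same_part E u a' & {in A, E u =1 E a'}]) /\
  {in A &, forall a a', same_part E a a' -> {in A, E a =1 E a'} -> a = a'}.

Hypothesis gA : good_seq.

Definition retract u : option V :=
  ohead [seq a <- A | same_part E u a && all (fun c => E u c == E a c) A].

Lemma retract_some u a : retract u = Some a ->
  [/\ a \in A, same_part E u a & {in A, E u =1 E a}].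
Proof.
rewrite /retract; case F: (seq.filter _ _) => [|b s] //= -[<-].
have : b \in [seq a <- A | same_part E u a && all (fun c => E u c == E a c) A].
  by rewrite F inE eqxx.
rewrite mem_filter => /andP[/andP[ub /allP row] bA]; split=> // c /row.
by move=> /eqP.
Qed.

Lemma retractE u a : sg -> a \in A -> same_part E u a -> {in A, E u =1 E a} ->
  retract u = Some a.
Proof.
move=> /gA[_ uniq_twin] aA ua row; rewrite /retract.
have : a \in [seq a <- A | same_part E u a && all (fun c => E u c == E a c) A].
  by rewrite mem_filter ua aA andbT; apply/allP => c /row->.
case F: (seq.filter _ _) => [|b s] // _; congr Some.
have : retract u = Some b by rewrite /retract F.
move=> /retract_some[bA ub rowb]; apply: uniq_twin => //.
  by rewrite -(same_part_left ME ub).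
by move=> c cA; rewrite -rowb// row.
Qed.

Lemma retract_id a : sg -> a \in A -> retract a = Some a.
Proof. by move=> s aA; apply: retractE. Qed.

Lemma retract_none u a : sg -> retract u = None -> a \in A -> ~~ same_part E u a.
Proof.
move=> s ru aA; apply/negP => /(gA s).1 -/(_ aA)[b [bA ub row]].
by rewrite (@retractE u b) in ru.
Qed.

(* The tags true and false distinguish copies of the two structures amalgamated
   over A. Parts are identified only when forced by A; a vertex whose part meets
   A behaves towards the other copy like its twin in A, and the remaining edges
   go from the first copy to the second. *)
Definition orient u v : bool :=
  if sg then
    if retract u is Some a then E a v
    else if retract v is Some b then E u b else true
  else (u \in A) ==> E u v.

Definition amalgam_part : rel (V * bool) := fun x y =>
  if x.2 == y.2 then same_part E x.1 y.1
  else has (fun a => same_part E x.1 a && same_part E a y.1) A.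

Definition amalgam_orient : rel (V * bool) := fun x y =>
  if x.2 == y.2 then E x.1 y.1
  else if x.2 then orient x.1 y.1 else ~~ orient y.1 x.1.

Definition amalgam_edge : rel (V * bool) := fun x y =>
  ~~ amalgam_part x y && amalgam_orient x y.

Lemma amalgam_part_same x y : amalgam_part x y -> same_part E x.1 y.1.
Proof.
rewrite /amalgam_part; case: eqP => // _ /hasP[a _ /andP[xa ay]].
exact: same_trans xa ay.
Qed.

Lemma amalgam_part_sym : symmetric amalgam_part.
Proof.
move=> x y; rewrite /amalgam_part (eq_sym y.2) same_part_sym; case: eqP => // _.
by apply: eq_has => a; rewrite andbC (same_part_sym _ _ y.1) (same_part_sym _ x.1).
Qed.

Lemma amalgam_part_trans : transitive amalgam_part.
Proof.
move=> y x z xy yz; have xz := same_trans (amalgam_part_same xy) (amalgam_part_same yz).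
move: xy yz; rewrite /amalgam_part.
case: (x.2 =P z.2) => // xz2; case: (x.2 =P y.2) => xy2; case: (y.2 =P z.2) => yz2.
- by case: xz2; rewrite xy2.
- move=> xy /hasP[a aA /andP[ya az]] //; apply/hasP; exists a => //.
  by rewrite (same_trans xy ya).
- move=> /hasP[a aA /andP[xa ay]] yz; apply/hasP; exists a => //.
  by rewrite xa (same_trans ay yz).
- by move: xz2 xy2 yz2; case: (x.2) (y.2) (z.2) => -[] [].
Qed.

Lemma amalgam_multipartite :
  multipartite amalgam_edge /\ same_part amalgam_edge =2 amalgam_part.
Proof.
apply: multipartite_relation => [x||y x z|x y].
- by rewrite /amalgam_part eqxx same_refl.
- exact: amalgam_part_sym.
- exact: amalgam_part_trans.
- rewrite /amalgam_part /amalgam_orient (eq_sym y.2); case: eqP => [_|xy2] nxy.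
    exact: edge_sym.
  by move: xy2; case: x.2; case: y.2 => //; rewrite negbK.
Qed.

Lemma amalgam_edge_sym x y : ~~ amalgam_part x y ->
  amalgam_edge x y = ~~ amalgam_edge y x.
Proof.
have [me eE] := amalgam_multipartite.
by rewrite -eE => nxy; exact: edge_sym.
Qed.

Lemma amalgam_edge_same x y : x.2 = y.2 -> amalgam_edge x y = E x.1 y.1.
Proof.
move=> xy; rewrite /amalgam_edge /amalgam_part /amalgam_orient xy eqxx.
by rewrite /same_part; case: (E x.1 y.1); rewrite ?andbF ?andbT.
Qed.

(** Although [orient] consults the first copy first, the outcome is symmetric: if [u] and [v] have
    twins [a] and [b], then [E a v] and [E u b] both equal [E a b]. *)
Lemma amalgam_edge_retract x y a : sg -> retract x.1 = Some a -> x.2 != y.2 ->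
  amalgam_edge x y = E a y.1.
Proof.
case: x y => [u s] [v t] /= Sg ru st.
have [aA ua row] := retract_some ru.
have [uv|nuv] := boolP (amalgam_part (u, s) (v, t)).
  rewrite /amalgam_edge uv /=; apply/esym/same_part_edge.
  by rewrite -(same_part_left ME ua); exact: amalgam_part_same uv.
rewrite /amalgam_edge nuv /amalgam_orient /= (negbTE st) /=.
have nav : ~~ same_part E a v.
  apply: contra nuv => av; rewrite /amalgam_part (negbTE st); apply/hasP.
  by exists a => //=; rewrite ua.
case: s st nuv => _ nuv; rewrite /orient Sg ru//.
case rv: (retract v) => [b|]; last by rewrite (edge_sym ME nav).
have [bA vb rowb] := retract_some rv.
have nab : ~~ same_part E a b.
  by apply: contra nav => ab; rewrite same_part_sym (same_part_left ME vb) same_part_sym.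
have nub : ~~ same_part E u b by rewrite (same_part_left ME ua).
rewrite -(edge_sym ME nub) row//.
by rewrite (edge_sym ME nab) (edge_sym ME nav) rowb.
Qed.

Lemma amalgam_even_meet (x y y' : V * bool) a : sg -> a \in A ->
    same_part E x.1 a -> amalgam_part y y' ->
  amalgam_edge x y (+) amalgam_edge x y' = E a y.1 (+) E a y'.1.
Proof.
move=> Sg aA xa yy'; have ev := EC.2 Sg.
case rx: (retract x.1) => [r|]; last first.
  by have := retract_none Sg rx aA; rewrite xa.
have [rA xr row] := retract_some rx.
(* Seen from the copy tagged [t], the vertex [x] behaves like [hat t]: itself in its own copy, its
   twin in the other. This reduces the claim to parity in [E]. *)
pose hat (t : bool) := if x.2 == t then x.1 else r.
have hatE z : amalgam_edge x z = E (hat z.2) z.1.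
  rewrite /hat; case: eqP => [/amalgam_edge_same//|/eqP xz].
  exact: amalgam_edge_retract.
have hat_a t : same_part E (hat t) a.
  by rewrite /hat; case: eqP => // _; rewrite -(same_part_left ME xr).
have hat_row t b : b \in A -> E (hat t) b = E x.1 b.
  by rewrite /hat; case: eqP => // _ bA; rewrite row.
rewrite !hatE; move: yy'; rewrite /amalgam_part; case: eqP => [<-|_].
  by move=> yy'; apply: ev.
move=> /hasP[b bA /andP[yb by']]; rewrite same_part_sym in by'.
have := ev _ _ _ _ (hat_a y.2) yb; have := ev _ _ _ _ (hat_a y'.2) by'.
rewrite !(hat_row _ b bA).
case: (E (hat y.2) _); case: (E (hat y'.2) _); case: (E x.1 b); case: (E a b);
  by case: (E a y.1); case: (E a y'.1).
Qed.

(** If one of the two parts meets [A], its vertices can be compared with a base point. A part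
    missing [A] lies in a single copy, so between two such parts the edges are inherited or all have
    the same direction. *)
Lemma amalgam_even : sg -> even_parity amalgam_edge.
Proof.
move=> Sg; have ev := EC.2 Sg; have [me eE] := amalgam_multipartite.
have meets x x' y y' a : a \in A -> same_part E x.1 a -> amalgam_part x x' ->
    amalgam_part y y' ->
    amalgam_edge x y (+) amalgam_edge x y' = amalgam_edge x' y (+) amalgam_edge x' y'.
  move=> aA xa /amalgam_part_same xx' yy'.
  rewrite (amalgam_even_meet Sg aA xa)// (amalgam_even_meet (x := x') Sg aA)//.
  by rewrite -(same_part_left ME xx').
move=> x x' y y'; rewrite !eE => xx' yy'.
have [/hasP[a aA xa]|nx] := boolP (has (same_part E x.1) A).
  exact: (meets _ _ _ _ a).
have [/hasP[a aA ya]|ny] := boolP (has (same_part E y.1) A).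
  have [xy|nxy] := boolP (amalgam_part x y).
    have ax : same_part E x.1 a by apply: same_trans ya; exact: amalgam_part_same.
    exact: (meets _ _ _ _ a).
  have P := @amalgam_part_trans; have S := amalgam_part_sym.
  have nxy' : ~~ amalgam_part x y' by apply: contra nxy => /P; apply; rewrite S.
  have nx'y : ~~ amalgam_part x' y by apply: contra nxy; exact: P.
  have nx'y' : ~~ amalgam_part x' y' by apply: contra nxy'; exact: P.
  rewrite !(amalgam_edge_sym nxy, amalgam_edge_sym nxy', amalgam_edge_sym nx'y,
    amalgam_edge_sym nx'y').
  have := meets y y' x x' a aA ya yy' xx'.
  by case: (amalgam_edge y x); case: (amalgam_edge y' x); case: (amalgam_edge y x');
    case: (amalgam_edge y' x').
have far z z' : ~~ has (same_part E z.1) A -> amalgam_part z z' -> z.2 = z'.2 /\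
    retract z'.1 = None /\ ~~ has (same_part E z'.1) A.
  move=> nz zz'; have zz1 := amalgam_part_same zz'; split.
    move: zz'; rewrite /amalgam_part; case: eqP => // _ /hasP[a aA /andP[za _]].
    by case/hasP: nz; exists a.
  have nz' : ~~ has (same_part E z'.1) A.
    by rewrite -(eq_has (same_part_left ME zz1)).
  split=> //; case rz: (retract _) => [a|//]; have [aA za _] := retract_some rz.
  by case/hasP: nz'; exists a.
have refl z : amalgam_part z z by rewrite -eE; exact: same_part_refl.
have [x2 [rx' _]] := far _ _ nx xx'; have [y2 [ry' _]] := far _ _ ny yy'.
have [_ [rx _]] := far _ _ nx (refl x); have [_ [ry _]] := far _ _ ny (refl y).
have [xy|nxy] := eqVneq x.2 y.2.
  rewrite !amalgam_edge_same -?x2 -?y2//; apply: ev; exact: amalgam_part_same.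
have cross z w : z.2 = x.2 -> w.2 = y.2 -> retract z.1 = None ->
    retract w.1 = None -> ~~ has (same_part E z.1) A -> amalgam_edge z w = x.2.
  move=> z2 w2 rz rw nz; rewrite /amalgam_edge /amalgam_part /amalgam_orient z2 w2.
  rewrite (negbTE nxy) /orient Sg rz rw.
  have -> : has (fun a => same_part E z.1 a && same_part E a w.1) A = false.
    by apply: contraNF nz => /hasP[a aA /andP[za _]]; apply/hasP; exists a.
  by case: x.2.
rewrite !cross//; have [_ [_ //]] := far _ _ nx xx'.
Qed.

Lemma amalgam_class : tournament_class sg amalgam_edge.
Proof. by split; [exact: amalgam_multipartite.1|exact: amalgam_even]. Qed.

Lemma orient_base u v : u \in A -> ~~ same_part E u v -> orient u v = E u v.
Proof.
move=> uA nuv; rewrite /orient; case: ifP => [Sg|_]; last by rewrite uA.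
by rewrite retract_id.
Qed.

(** Base vertices carry the tag of the first copy, so the two copies share [A], and this is the
    embedding of the second structure. *)
Lemma amalgam_edge_second u v : amalgam_edge (u, u \in A) (v, v \in A) = E u v.
Proof.
have [uv|] := eqVneq (u \in A) (v \in A).
  exact: amalgam_edge_same.
rewrite /amalgam_edge /amalgam_part /amalgam_orient /= => /negbTE uv; rewrite uv.
have [sp|nsp] := boolP (same_part E u v).
  rewrite (same_part_edge sp); apply/negbTE; rewrite negb_and negbK; apply/orP; left.
  apply/hasP; case: (boolP (u \in A)) uv => [uA|_ /negbFE vA].
    by exists u => //; rewrite same_refl.
  by exists v => //; rewrite sp same_refl.
have -> : has (fun a => same_part E u a && same_part E a v) A = false.
  by apply: contraNF nsp => /hasP[a _ /andP[]]; exact: same_trans.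
case: (boolP (u \in A)) uv => [uA _|_ /negbFE vA] /=; first exact: orient_base.
by rewrite (edge_sym ME nsp) orient_base// same_part_sym.
Qed.

Section Equivariance.
Variables f1 f2 : automorphism E.
Hypothesis f1A : {in A, forall a, f1 a \in A}.
Hypothesis f12 : {in A, f1 =1 f2}.

Let aut_inj (f : automorphism E) : injective f := can_inj (aut_funK f).

Lemma stable_preimage (f : automorphism E) : {in A, forall a, f a \in A} ->
  {in A, forall a, exists2 b, b \in A & f b = a}.
Proof.
move=> fA a; rewrite -mem_undup => aA.
have : a \in map f (undup A).
  suff /(uniq_min_size _)[]: {subset map f (undup A) <= undup A}.
  - by rewrite map_inj_uniq ?undup_uniq//; exact: aut_inj.
  - by rewrite size_map.
  - by move=> _ ->.
  by move=> _ /mapP[b + ->]; rewrite !mem_undup; exact: fA.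
by move=> /mapP[b + ->]; rewrite mem_undup => bA; exists b.
Qed.

Lemma same_part_aut (f : automorphism E) u v :
  same_part E (f u) (f v) = same_part E u v.
Proof. by rewrite /same_part !aut_edge. Qed.

Lemma retract_aut (f : automorphism E) u : sg -> {in A, forall a, f a \in A} ->
  retract (f u) = omap f (retract u).
Proof.
move=> Sg fA; case ru: (retract u) => [a|] /=.
  have [aA ua row] := retract_some ru.
  apply: retractE; rewrite ?fA ?same_part_aut// => c /(stable_preimage fA)[d dA <-].
  by rewrite !aut_edge row.
case rfu: (retract _) => [b|//]; have [bA fub row] := retract_some rfu.
have [c cA cb] := stable_preimage fA bA; rewrite -cb in fub row.
rewrite same_part_aut in fub; move: ru; rewrite (@retractE _ c)// => d dA.
by have := row (f d) (fA _ dA); rewrite !aut_edge.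
Qed.

Definition glue (x : V * bool) := (if x.2 then f1 x.1 else f2 x.1, x.2).

Let f2A : {in A, forall a, f2 a \in A}.
Proof. by move=> a aA; rewrite -f12// f1A. Qed.

Let link_aut u v :
  has (fun a => same_part E (f1 u) a && same_part E a (f2 v)) A =
  has (fun a => same_part E u a && same_part E a v) A.
Proof.
apply/hasP/hasP => [[a /(stable_preimage f1A)[b bA <-]]|[a aA /andP[ua av]]].
  by rewrite same_part_aut f12// same_part_aut => ?; exists b.
by exists (f1 a); [exact: f1A|rewrite same_part_aut ua f12// same_part_aut av].
Qed.

Let orient_aut u v : orient (f1 u) (f2 v) = orient u v.
Proof.
rewrite /orient; case: ifP => [Sg|_].
  rewrite !retract_aut//; case ru: (retract u) => [a|] /=.
    by have [aA _ _] := retract_some ru; rewrite f12// aut_edge.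
  case rv: (retract v) => [b|] //=.
  by have [bA _ _] := retract_some rv; rewrite -f12// aut_edge.
have [uA|uA] := boolP (u \in A); first by rewrite f1A// f12// aut_edge.
suff /negbTE-> : f1 u \notin A by [].
by apply: contra uA => /(stable_preimage f1A)[b bA /aut_inj<-].
Qed.

Let glue_part x y : amalgam_part (glue x) (glue y) = amalgam_part x y.
Proof.
wlog : x y / x.2 >= y.2 => [hwlog|].
  have [|/ltnW] := leqP y.2 x.2; first exact: hwlog.
  by rewrite amalgam_part_sym (amalgam_part_sym x); exact: hwlog.
case: x y => [u s] [v t]; rewrite /amalgam_part /glue /=.
by case: s t => -[]// _; rewrite ?same_part_aut ?link_aut.
Qed.

Lemma glue_edge x y : amalgam_edge (glue x) (glue y) = amalgam_edge x y.
Proof.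
rewrite /amalgam_edge glue_part; congr (_ && _).
case: x y => [u []] [v []]; rewrite /amalgam_orient /glue /= ?aut_edge//.
all: by rewrite orient_aut.
Qed.

Lemma glue_inj : injective glue.
Proof.
by move=> [u []] [v []] // [] /aut_inj->.
Qed.

End Equivariance.
End Amalgam.

(** * The Fraïssé limit and its automorphisms *)

Section TournamentLimit.
Variables (V : choiceType) (E : rel V) (sg : bool).
Hypothesis V_countable : countable [set: V]%classic.
Hypothesis E_homogeneous : homogeneous E.
Hypothesis E_age : forall (T : finType) (e : rel T),
  embeds E e <-> tournament_class sg e.

Let aut_inj (f : automorphism E) : injective f := can_inj (aut_funK f).

(** Each axiom involves at most four vertices, so it is tested on finite substructures. *)
Lemma limit_class : tournament_class sg E.
Proof.
have sub (s : seq V) : tournament_class sg (relpre (val : seq_sub s -> V) E).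
  by apply/E_age; exists val; split=> //; exact: val_inj.
split; first split=> [x|x y|y x z].
- have [[irr _ _] _] := sub [:: x]; have xs : x \in [:: x] by rewrite inE.
  exact: (irr (SeqSub xs)).
- have [[_ asym _] _] := sub [:: x; y].
  have xs : x \in [:: x; y] by rewrite !inE eqxx.
  have ys : y \in [:: x; y] by rewrite !inE eqxx orbT.
  exact: (asym (SeqSub xs) (SeqSub ys)).
- have [[_ _ tr] _] := sub [:: x; y; z].
  have xs : x \in [:: x; y; z] by rewrite !inE eqxx.
  have ys : y \in [:: x; y; z] by rewrite !inE eqxx orbT.
  have zs : z \in [:: x; y; z] by rewrite !inE eqxx !orbT.
  exact: (tr (SeqSub ys) (SeqSub xs) (SeqSub zs)).
- move=> Sg x x' y y'; have [_ /(_ Sg) ev] := sub [:: x; x'; y; y'].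
  have xs : x \in [:: x; x'; y; y'] by rewrite !inE eqxx.
  have x's : x' \in [:: x; x'; y; y'] by rewrite !inE eqxx orbT.
  have ys : y \in [:: x; x'; y; y'] by rewrite !inE eqxx !orbT.
  have y's : y' \in [:: x; x'; y; y'] by rewrite !inE eqxx !orbT.
  exact: (ev (SeqSub xs) (SeqSub x's) (SeqSub ys) (SeqSub y's)).
Qed.

Lemma homogeneous_seq (I : choiceType) (L : seq I) (x y : I -> V) :
    {in L &, forall i j, (x i == x j) = (y i == y j)} ->
    {in L &, forall i j, E (x i) (x j) = E (y i) (y j)} ->
  exists g : automorphism E, {in L, forall i, g (x i) = y i}.
Proof.
move=> xy exy; have [[i0 i0L]|L0] := pselect (exists i, i \in L); last first.
  by exists 1%g => i iL; case: L0; exists i.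
pose f v := nth (y i0) (map y L) (index v (map x L)).
have fE i : i \in L -> f (x i) = y i.
  move=> iL; rewrite /f; set m := index _ _.
  have mL : m < size L by rewrite -(size_map x) index_mem map_f.
  rewrite (nth_map i0)//; apply/eqP; rewrite -xy ?mem_nth//.
  by rewrite -(nth_map i0 (x i0))// nth_index// map_f.
have inA v : [set` map x L]%classic v -> exists2 i, i \in L & v = x i.
  by move=> /= /mapP.
have [|||g gE] := @E_homogeneous [set` map x L]%classic
    [set f v | v in [set` map x L]]%classic f.
- exact: finite_seq.
- split=> // v w /set_mem/inA[i iL ->] /set_mem/inA[j jL ->].
  by rewrite !fE// => /eqP; rewrite -xy// => /eqP.
- by move=> _ _ /inA[i iL ->] /inA[j jL ->]; rewrite !fE// exy.
- by exists g => i iL; rewrite gE ?fE//=; exact: map_f.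
Qed.

Lemma limit_extension (U : choiceType) (e : rel U) (L L0 : seq U) (x : U -> V) :
    tournament_class sg e -> {subset L0 <= L} ->
    {in L0 &, injective x} -> {in L0 &, forall i j, E (x i) (x j) = e i j} ->
  exists j : U -> V, [/\ {in L &, injective j},
    {in L &, forall s t, E (j s) (j t) = e s t} & {in L0, j =1 x}].
Proof.
move=> eC L0L xI xe.
have [j0 [j0I j0E]] : embeds E (relpre (val : seq_sub L -> U) e).
  by apply/E_age; exact: tournament_class_relpre.
have [[s0 s0L]|L_nil] := pselect (exists s, s \in L); last first.
  exists x; split=> [s t sL|s t sL|//]; by case: L_nil; exists s.
pose j1 s := j0 (insubd (SeqSub s0L) s).
have j1I : {in L &, injective j1}.
  by move=> s t sL tL /j0I/(congr1 val); rewrite !insubdK.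
have j1E : {in L &, forall s t, E (j1 s) (j1 t) = e s t}.
  by move=> s t sL tL; rewrite j0E /= !insubdK.
have [s t sL tL|s t sL tL|g gE] := @homogeneous_seq _ L0 j1 x.
- apply/eqP/eqP => [/j1I->//|/xI->//]; exact: L0L.
- by rewrite j1E ?xe//; exact: L0L.
exists (g \o j1); split=> [s t sL tL|s t sL tL|s sL0] /=.
- by move=> /aut_inj; exact: j1I.
- by rewrite aut_edge j1E.
- exact: gE.
Qed.

Let act (g : automorphism E) : V -> V := g.

Lemma limit_eppa (A : seq V) : exists B : seq V,
  [/\ {subset A <= B}, good_seq E sg B
    & forall (p : automorphism E) (S : seq V), {subset S <= A} ->
        {in S, forall v, p v \in A} ->
        exists2 g : automorphism E, stable act g B & {in S, g =1 p}].
Proof.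
have EC := limit_class; have ME := EC.1.
pose eA := relpre (val : seq_sub A -> V) E.
have [B [eB [f [BC fI fE Bext Bsat]]]] :=
  tournament_eppa (tournament_class_relpre (val : seq_sub A -> V) EC).
have [[a0 a0A]|A_nil] := pselect (exists a, a \in A); last first.
  exists [::]; split=> [v vA|Sg|p S SA _]; first by case: A_nil; exists v.
    by split.
  exists 1%g => // v /SA vA; case: A_nil; by exists v.
pose x b := val (odflt (SeqSub a0A) [pick a | f a == b]).
have xf a : x (f a) = val a.
  rewrite /x; case: pickP => [b /eqP/fI->//|/(_ a)]; by rewrite eqxx.
have [|||j [jI jE jx]] := @limit_extension B eB (enum B) (codom f) x BC.
- by move=> b _; rewrite mem_enum.
- by move=> _ _ /codomP[a ->] /codomP[b ->]; rewrite !xf => /val_inj->.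
- by move=> _ _ /codomP[a ->] /codomP[b ->]; rewrite !xf fE.
have {}jI : injective j by move=> s t; apply: jI; rewrite mem_enum.
have {}jE s t : E (j s) (j t) = eB s t by apply: jE; rewrite mem_enum.
have jf a : j (f a) = val a by rewrite jx ?xf ?codom_f.
have j_same s t : same_part E (j s) (j t) = same_part eB s t.
  by rewrite /same_part !jE.
exists (map j (enum B)); split=> [v vA|Sg|p S SA pSA].
- by have /= <- := jf (SeqSub vA); rewrite map_f// mem_enum.
- have [sat1 sat2] := Bsat Sg; have ev := EC.2 Sg; split.
    move=> u _ /mapP[b _ ->] ub.
    have [d|d d'|b' [bb' zb']] := sat1 b (fun d => E u (j d)).
    + by rewrite -j_same => bd; apply: same_part_edge; rewrite (same_part_left ME ub).
    + by rewrite -j_same -!jE => dd'; apply: ev.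
    exists (j b'); split; first by rewrite map_f// mem_enum.
      by rewrite (same_part_left ME ub) j_same.
    by move=> _ /mapP[d _ ->]; rewrite jE -zb'.
  move=> _ _ /mapP[b _ ->] /mapP[b' _ ->]; rewrite j_same => bb' row.
  congr j; apply: sat2 => // d; rewrite -!jE; apply: row.
  by rewrite map_f// mem_enum.
- pose p0 (a : seq_sub A) : seq_sub A := insubd a (p (val a)).
  have p0E a : val a \in S -> val (p0 a) = p (val a).
    by move=> aS; rewrite insubdK//; exact: pSA.
  have [a b aS bS|a b aS bS|h [hI hE hf]] := Bext [pred a | val a \in S] p0.
  + by move=> /(congr1 val); rewrite !p0E// => /aut_inj/val_inj.
  + by rewrite /= !p0E// aut_edge.
  have [s t _ _|s t _ _|g gE] := @homogeneous_seq B (enum B) j (j \o h).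
  + by rewrite /= !(inj_eq jI) (inj_eq hI).
  + by rewrite /= !jE hE.
  exists g => [_ /mapP[b bB ->]|v vS].
    by rewrite /act gE//= map_f// mem_enum.
  have vA := SA v vS; have /= <- := jf (SeqSub vA).
  by rewrite gE ?mem_enum//= hf//= !jf p0E.
Qed.

(** The amalgam is realized in the limit with its first copy in place; homogeneity gives [k] moving
    [B2] to the second copy, and later realizes the glued maps by automorphisms. *)
Lemma limit_amalgamation (A B1 B2 : seq V) :
    good_seq E sg A -> {subset A <= B1} -> {subset A <= B2} ->
  exists2 k : automorphism E, fixes act k A & forall f1 f2 : automorphism E,
    stable act f1 B1 -> stable act f1 A -> stable act f2 B2 -> {in A, f1 =1 f2} ->
    exists2 f : automorphism E, {in B1, f =1 f1} &
      {in B2, forall b, f (k b) = k (f2 b)}.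
Proof.
have EC := limit_class => gA AB1 AB2.
pose first_copy := [seq (v, true) | v <- B1].
pose second_copy := [seq (v, v \in A) | v <- B2].
pose L := first_copy ++ second_copy.
have B1L v : v \in B1 -> (v, true) \in L.
  by move=> vB1; rewrite mem_cat map_f.
have B2L v : v \in B2 -> (v, v \in A) \in L.
  by move=> vB2; rewrite mem_cat (map_f (fun v => (v, v \in A))) ?orbT.
have [|||j [jI jE jx]] := @limit_extension _ (amalgam_edge E sg A) L first_copy fst
    (amalgam_class EC gA).
- by move=> v vB1; rewrite mem_cat vB1.
- by move=> _ _ /mapP[u _ ->] /mapP[v _ ->] /= ->.
- by move=> _ _ /mapP[u _ ->] /mapP[v _ ->]; rewrite amalgam_edge_same.
have {}jx v : v \in B1 -> j (v, true) = v by move=> vB1; rewrite jx//= map_f.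
have [u v uB2 vB2|u v uB2 vB2|k kE] := @homogeneous_seq _ B2 id
    (fun v => j (v, v \in A)).
- apply/eqP/eqP => [->//|juv].
  by have [] := jI _ _ (B2L u uB2) (B2L v vB2) juv.
- by rewrite jE ?amalgam_edge_second//; exact: B2L.
exists k => [v vA|f1 f2 f1B1 f1A f2B2 f12].
  by rewrite /act kE ?AB2// vA jx// AB1.
have f2A v : (f2 v \in A) = (v \in A).
  have f2sA : {in A, forall a, f2 a \in A} by move=> a aA; rewrite -f12// f1A.
  apply/idP/idP => [f2v|/f2sA//].
  by have [b bA /aut_inj<-] := stable_preimage f2sA f2v.
pose th := glue f1 f2.
have thL x : x \in L -> th x \in L.
  rewrite mem_cat => /orP[/mapP[v vB1 ->]|/mapP[v vB2 ->]]; rewrite /th /glue /=.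
    by apply: B1L; exact: f1B1.
  case: ifP => vA; first by apply: B1L; apply: f1B1; exact: AB1.
  by have := B2L _ (f2B2 _ vB2); rewrite /act f2A vA.
have [x y xL yL|x y xL yL|f fE] := @homogeneous_seq _ L j (j \o th).
- apply/eqP/eqP => /= [/jI->//|/jI xy]; congr j.
  by apply: (@glue_inj _ _ f1 f2); apply: xy; exact: thL.
- by rewrite /= !jE ?thL// glue_edge.
exists f => [v vB1|v vB2].
  by rewrite -[in LHS](jx v)// fE ?B1L//= jx//; exact: f1B1.
rewrite !kE ?fE//=; [|exact: B2L|exact: f2B2].
rewrite /th /glue /= f2A; case: ifP => // vA; by rewrite f12.
Qed.

(** A double coset is determined by how [A] and its labelled image are related, for which there are
    finitely many possibilities: if [f] has the same type as [g], some [u] fixes [A] and carries the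
    image under [g] to that under [f]. *)
Lemma limit_oligomorphic (A : seq V) : exists F : seq (automorphism E),
  forall g : automorphism E, exists f u v : automorphism E,
    [/\ f \in F, fixes act u A, fixes act v A & g = (u * f * v)%g].
Proof.
pose I : finType := seq_sub A.
pose type_of (g : automorphism E) := [ffun ij : I * I =>
  (val ij.1 == g (val ij.2), E (val ij.1) (g (val ij.2)), E (g (val ij.2)) (val ij.1))].
have /choice[r rP] : forall t, exists f, (exists g, type_of g = t) -> type_of f = t.
  move=> t; have [[f fP]|nf] := pselect (exists g, type_of g = t); first by exists f.
  by exists 1%g => /nf.
exists [seq r t | t : {ffun I * I -> bool * bool * bool}] => g.
set f := r (type_of g).
have /ffunP fg : type_of f = type_of g by apply: rP; exists g.
pose x (g : automorphism E) (i : I + I) :=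
  match i with inl a => val a | inr a => g (val a) end.
have fgE (a b : I) : [/\ (val a == f (val b)) = (val a == g (val b)),
    E (val a) (f (val b)) = E (val a) (g (val b))
  & E (f (val b)) (val a) = E (g (val b)) (val a)].
  by have := fg (a, b); rewrite !ffunE /= => -[].
have [i j _ _|i j _ _|u uE] := @homogeneous_seq (I + I)%type (enum {: I + I}) (x g) (x f).
- case: i j => [a|a] [b|b] /=; rewrite ?(inj_eq (@aut_inj _))//.
    by have [-> _ _] := fgE a b.
  by rewrite eq_sym [RHS]eq_sym; have [-> _ _] := fgE b a.
- case: i j => [a|a] [b|b] /=; rewrite ?aut_edge//.
    by have [_ -> _] := fgE a b.
  by have [_ _ ->] := fgE b a.
exists f, u^-1%g, (f^-1 * u * g)%g; split.
- by apply/mapP; exists (type_of g) => //; rewrite mem_enum.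
- move=> a aA; have /= ua := uE (inl (SeqSub aA)).
  by apply: (@aut_inj u); rewrite ua ?mem_enum//; exact: (aut_invK u a).
- move=> a aA; have /= ua := uE (inr (SeqSub aA)).
  apply: (@aut_inj f); rewrite -[RHS]ua ?mem_enum//; exact: (aut_invK f).
- by rewrite !mulgA mulgK mulVg mul1g.
Qed.

Lemma automorphism_closed (h : V -> V) : injective h ->
    (forall w, exists v, h v = w) ->
    (forall A : seq V, exists g : automorphism E, {in A, g =1 h}) ->
  exists g : automorphism E, g =1 h.
Proof.
move=> hI hS happ; have /choice[h' h'K] := hS.
have hK : cancel h h' by move=> v; apply: hI; rewrite h'K.
have hE x y : E (h x) (h y) = E x y.
  have [g gE] := happ [:: x; y].
  by rewrite -!gE ?aut_edge// !inE eqxx ?orbT.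
by exists (Automorphism hK h'K hE).
Qed.

Lemma limit_enumeration : exists en : nat -> V, forall v, exists n, en n = v.
Proof.
(* The one-vertex tournament embeds, so [V] is inhabited and a default value exists. *)
have /E_age[v0 _] : tournament_class sg (fun _ _ : unit => false).
  by split.
have /pcard_leP[f] := V_countable.
pose en n := if pselect (exists v, f v = n) is left vP then projT1 (cid vP) else v0 tt.
exists en => v; exists (f v); rewrite /en; case: pselect => [vP|[]]; last by exists v.
by case: cid => w /= /(inj (f := f)); apply; rewrite inE.
Qed.

Lemma good_seq_aut (g : automorphism E) (A : seq V) :
  good_seq E sg A -> good_seq E sg (map g A).
Proof.
move=> gA Sg; have [twins uniq_twin] := gA Sg; split.
  move=> u _ /mapP[a aA ->] ua; set u' := aut_inv g u.
  have uE : u = g u' by rewrite aut_invK.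
  have [a' [a'A ua' row]] : exists a',
      [/\ a' \in A, same_part E u' a' & {in A, E u' =1 E a'}].
    by apply: twins aA _; rewrite -(same_part_aut g) -uE.
  exists (g a'); split; [exact: map_f|by rewrite uE same_part_aut|].
  by move=> _ /mapP[c cA ->]; rewrite uE !aut_edge row.
move=> _ _ /mapP[a aA ->] /mapP[a' a'A ->]; rewrite same_part_aut => aa' row.
congr (g _); apply: uniq_twin => // c cA.
by rewrite -(aut_edge g) row ?map_f// aut_edge.
Qed.

Lemma limit_small_index (H : set (automorphism E)) : is_subgroup H ->
    (left_cosets H #<= [set: set nat])%card ->
    ~~ (left_cosets H #= [set: set nat])%card ->
  exists A, forall g, fixes act g A -> H g.
Proof.
have [en en_surj] := limit_enumeration.
exact: (@small_index_open _ _ act en (fun=> erefl) (fun _ _ _ => erefl)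
  (@aut_ext _ E) automorphism_closed en_surj _ good_seq_aut limit_eppa
  limit_amalgamation).
Qed.

Lemma limit_bergman : bergman_property (automorphism E) 21.
Proof.
have [en en_surj] := limit_enumeration.
exact: (@bergman_property21 _ _ act en (fun=> erefl) (fun _ _ _ => erefl)
  (@aut_ext _ E) automorphism_closed en_surj _ good_seq_aut limit_eppa
  limit_amalgamation limit_oligomorphic).
Qed.

End TournamentLimit.

(** * Fixed points of isometric actions *)

Section BergmanConsequences.
Variables (G : groupType) (k : nat).
Hypothesis G_bergman : bergman_property G k.
Local Open Scope group_scope.

Lemma bergman_uncountable_cofinality : uncountable_cofinality G.
Proof.
move=> [H [Hs Hmono Hcov]]; have [n nP] := G_bergman Hmono Hcov.
have [[H1 HM _] HnT] := (subgroupP (Hs n).1, (Hs n).2).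
apply: HnT; apply/seteqP; split=> // g _.
have [w wH <-] : set_power k (H n) g by rewrite nP.
by apply: (big_ind (H n)).
Qed.

(** Here [W n] is the ball of radius [n] of a length function; a ball whose k-th power is the group
    bounds the length by [k * n]. *)
Lemma bergman_bounded (W : nat -> set G) : W 0 1 ->
    (forall n g, W n g -> W n.+1 g) ->
    (forall m n g h, W m g -> W n h -> W (m + n)%N (g * h)) ->
    (forall g, exists n, W n g) ->
  exists n, forall g, W n g.
Proof.
move=> W1 WS WM Wcov; have [|n nP] := G_bergman WS.
  by apply/seteqP; split=> // g _; have [n Wn] := Wcov g; exists n.
exists (k * n)%N => g; have [w wW <-] : set_power k (W n) g by rewrite nP.
elim: {nP g} k w wW => [|j IHj] w wW; first by rewrite big_ord0.
by rewrite big_ord_recl mulSn; apply: WM; [exact: wW|apply: IHj => i; exact: wW].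
Qed.

End BergmanConsequences.

(** * Centres of bounded orbits in trees *)

Section Tree.
Variables (T : eqType) (adj : rel T).
Hypothesis T_tree : is_tree adj.

Let adj_sym : symmetric adj. Proof. by case: T_tree. Qed.
Let adj_irr : irreflexive adj. Proof. by case: T_tree. Qed.
Let acyclic (c : seq T) : 2 < size c -> uniq c -> ~~ cycle adj c.
Proof. by case: T_tree => _ _ _ _; exact. Qed.

Definition joined x y n : Prop :=
  exists p, [/\ path adj x p, last x p = y & size p = n].

Lemma tree_joined x y : exists n, `[< joined x y n >].
Proof.
have [_ _ _ /(_ x y)[p [xp xy]] _] := T_tree.
by exists (size p); apply/asboolP; exists p.
Qed.

Definition dist x y : nat := ex_minn (tree_joined x y).

Lemma dist_joined x y : joined x y (dist x y).
Proof. by rewrite /dist; case: ex_minnP => n /asboolP. Qed.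

Lemma dist_le x y p : path adj x p -> last x p = y -> dist x y <= size p.
Proof.
move=> xp xy; rewrite /dist; case: ex_minnP => n _; apply; apply/asboolP.
by exists p.
Qed.

Lemma dist_refl x : dist x x = 0.
Proof. by apply/eqP; rewrite -leqn0; apply: (@dist_le x x [::]). Qed.

Lemma dist_eq0 x y : dist x y = 0 -> x = y.
Proof.
move=> d0; have [p [_ py]] := dist_joined x y.
by rewrite d0 => /size0nil p0; rewrite -py p0.
Qed.

Lemma dist_triangle y x z : dist x z <= dist x y + dist y z.
Proof.
have [p [xp py <-]] := dist_joined x y; have [q [yq qz <-]] := dist_joined y z.
by rewrite -size_cat; apply: dist_le; rewrite ?cat_path ?last_cat py ?xp.
Qed.

Lemma dist_map (f : T -> T) x y : (forall u v, adj (f u) (f v) = adj u v) ->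
  dist (f x) (f y) <= dist x y.
Proof.
move=> fadj; have [p [xp py <-]] := dist_joined x y; rewrite -(size_map f).
apply: dist_le; last by rewrite last_map py.
by elim: p x xp {py} => //= u p IHp x /andP[xu up]; rewrite fadj xu IHp.
Qed.

Lemma geodesic_avoids o v w : adj v w -> dist w o <= dist v o ->
  exists p, [/\ path adj w p, last w p = o & v \notin w :: p].
Proof.
move=> vw le; have [p [wp po psz]] := dist_joined w o; exists p; split=> //.
rewrite inE negb_or; apply/andP; split.
  by apply: contraTneq vw => ->; rewrite adj_irr.
apply/negP => vp; case/splitPr: p / vp wp po psz => p1 p2.
rewrite cat_path last_cat /= => /and3P[_ _ vp2] po psz.
have := leq_trans le (dist_le vp2 po); rewrite -psz size_cat /=.
by rewrite addnS ltnNge leq_addl.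
Qed.

(* Two such neighbours would be joined by a path avoiding v. *)
Lemma unique_closer_neighbour o v w w' : adj v w -> adj v w' ->
  dist w o <= dist v o -> dist w' o <= dist v o -> w = w'.
Proof.
move=> vw vw' wo w'o; apply: contrapT => /eqP ww'.
have [p [wp po vp]] := geodesic_avoids vw wo.
have [q [w'q qo vq]] := geodesic_avoids vw' w'o.
pose r := p ++ rev (belast w' q).
have wr : path adj w r.
  rewrite cat_path wp po -qo rev_path /=.
  by rewrite (eq_path (e' := adj))// => x y; exact: adj_sym.
have r_last : last w r = w'.
  rewrite last_cat po; case: q {w'q vq r wr} qo => [<-//|u q] _.
  by rewrite /= rev_cons last_rcons.
have vr : v \notin w :: r.
  rewrite inE mem_cat mem_rev !negb_or; move: vp; rewrite inE negb_or => /andP[-> ->] /=.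
  by apply: contra vq => /mem_belast.
case/shortenP: wr r_last => s ws us sr s_last.
have szs : 2 < size [:: v, w & s].
  by case: s s_last {ws us sr} => //= ww; rewrite ww eqxx in ww'.
have uvs : uniq [:: v, w & s].
  rewrite cons_uniq us andbT; apply: contra vr; rewrite !inE.
  by case/orP => [->//|/sr->]; rewrite orbT.
have := acyclic szs uvs.
by rewrite /cycle rcons_path /= vw ws s_last adj_sym vw'.
Qed.

(** Once a simple path fails to approach [o], it recedes at every step: its previous vertex is the
    only neighbour that is not farther from [o]. *)
Lemma dist_increasing o u v p : path adj u (v :: p) -> uniq (u :: v :: p) ->
  dist u o <= dist v o -> dist v o + size p <= dist (last v p) o.
Proof.
elim: p u v => [|w p IHp] u v; first by rewrite addn0.
move=> /= /and3P[uv vw wp] /and4P[]; rewrite !inE !negb_or => /and3P[_ uw _].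
move=> /andP[vw' vp] wp' up le.
have lt : dist v o < dist w o.
  rewrite ltnNge; apply: contra uw => le'; apply/eqP.
  by apply: unique_closer_neighbour le le' => //; rewrite adj_sym.
apply: leq_trans (IHp v w _ _ (ltnW lt)); first by rewrite addnS -addSn leq_add2r.
  by rewrite /= vw wp.
by rewrite /= !inE negb_or vw' vp wp'.
Qed.

Variables (G : groupType) (act : G -> T -> T).
Hypothesis actP : is_group_action act.
Hypothesis act_adj : forall g x y, adj (act g x) (act g y) = adj x y.
Hypothesis act_inversion : forall g x y, adj x y -> ~ (act g x = y /\ act g y = x).
Local Open Scope group_scope.

Let actK g : cancel (act g) (act g^-1).
Proof. by move=> x; rewrite -actP.2 mulVg actP.1. Qed.

Let actVK g : cancel (act g^-1) (act g).
Proof. by move=> x; rewrite -actP.2 mulgV actP.1. Qed.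

Lemma dist_act g x y : dist (act g x) (act g y) = dist x y.
Proof.
apply/eqP; rewrite eqn_leq dist_map//=.
by rewrite -{1}(actK g x) -{1}(actK g y) dist_map.
Qed.

(** The vertices of least radius form an invariant set, any two of them are adjacent, and a tree has
    no triangle. They are thus a vertex or an edge, and the edge cannot be inverted. *)
Lemma bounded_orbit_fixed_point x0 n :
  (forall g, dist x0 (act g x0) <= n) -> has_fixed_point act.
Proof.
move=> bnd; pose radius v m := forall g, dist v (act g x0) <= m.
have [m [[v0 v0m] minm]] : exists m, (exists v, radius v m) /\
    forall v m', radius v m' -> m <= m'.
  have exm : exists m, `[< exists v, radius v m >].
    by exists n; apply/asboolP; exists x0.
  case: (ex_minnP exm) => m /asboolP ? minm; exists m; split=> // v m' vm'.
  by apply: minm; apply/asboolP; exists v.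
have radius_act g v : radius v m -> radius (act g v) m.
  by move=> vm h; rewrite -{1}(actVK g (act h x0)) dist_act -actP.2.
have center_adj x y : radius x m -> radius y m -> x != y -> adj x y.
  move=> xm ym xy; have [_ _ _ /(_ x y)[p [xp py]] _] := T_tree.
  case/shortenP: xp py => -[|u [|w q]] /= xq uq _ py.
  - by rewrite py eqxx in xy.
  - by move: xq; rewrite andbT py.
  case: m v0m minm radius_act xm ym => [|m] v0m minm _ xm ym.
    have e z : radius z 0 -> z = act 1 x0.
      by move=> /(_ 1); rewrite leqn0 => /eqP/dist_eq0.
    by rewrite (e x xm) (e y ym) eqxx in xy.
  (* A vertex strictly between two centres has smaller radius: otherwise some orbit point would
     recede along the path beyond the radius of its end [y]. *)
  suff /minm : radius u m by rewrite ltnn.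
  move=> g; rewrite leqNgt; apply/negP => lt.
  have := @dist_increasing (act g x0) x u (w :: q) xq uq (leq_trans (xm g) lt).
  rewrite /= py leqNgt (leq_ltn_trans (ym g))//.
  by rewrite addnS ltnS (leq_trans lt)// leq_addr.
have [fix0|] := pselect (forall g, act g v0 = v0); first by exists v0.
move=> /existsNP[h /eqP hv0]; exfalso.
set y := act h v0 in hv0; have ym : radius y m by exact: radius_act.
have vy : adj v0 y by apply: center_adj => //; rewrite eq_sym.
have center z : radius z m -> z = v0 \/ z = y.
  move=> zm; have [->|zv] := eqVneq z v0; first by left.
  have [->|zy] := eqVneq z y; first by right.
  have uvyz : uniq [:: v0; y; z].
    by rewrite /= !inE negb_or eq_sym hv0 (eq_sym v0) zv (eq_sym y) zy.
  have := acyclic (isT : 2 < size [:: v0; y; z]) uvyz.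
  by rewrite /= vy center_adj// 1?eq_sym// center_adj.
have [hy|hy] := center _ (radius_act h y ym).
  exact: (act_inversion vy (conj erefl hy)).
by have /(can_inj (actK h)) yv := hy; rewrite -/y yv eqxx in hv0.
Qed.

End Tree.

Lemma bergman_property_FA (G : groupType) k :
  bergman_property G k -> property_FA G.
Proof.
move=> bG T adj act T_tree actP act_adj act_inv.
have [_ _ [x0 _] _ _] := T_tree.
have [|n g Wg|m n g h Wg Wh|g|n nP] := bergman_bounded bG
    (W := fun n g => dist T_tree x0 (act g x0) <= n).
- by rewrite actP.1 dist_refl.
- exact: leqW.
- rewrite actP.2; apply: leq_trans (dist_triangle _ (act g x0) _ _) _.
  by rewrite leq_add// (dist_act T_tree actP act_adj).
- by exists (dist T_tree x0 (act g x0)).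
- exact: (bounded_orbit_fixed_point actP act_adj act_inv nP).
Qed.

(** * Chebyshev centres in Hilbert spaces *)

Section ChebyshevCenter.
Import Order.TTheory GRing.Theory Num.Theory numFieldNormedType.Exports.
Local Open Scope ring_scope.
Local Open Scope classical_set_scope.
Variables (R : realType) (H : completeNormedModType R) (dot : {dot H for idfun}).
Hypothesis norm_dot : forall x : H, `|x| ^+ 2 = dot x x.

Lemma parallelogram (x y : H) :
  `|x + y| ^+ 2 + `|x - y| ^+ 2 = 2 * (`|x| ^+ 2 + `|y| ^+ 2).
Proof.
have Dl u v z : dot (u + v) z = dot u z + dot v z by rewrite linearDl.
have Dr u v z : dot z (u + v) = dot z u + dot z v by rewrite linearDr.
have Nl u z : dot (- u) z = - dot u z by rewrite linearNl.
have Nr u z : dot z (- u) = - dot z u by rewrite linearNr.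
rewrite !norm_dot !(Dl, Dr, Nl, Nr); ring.
Qed.

Variable O : set H.
Hypothesis O_neq0 : O !=set0.

Definition covering_radius (v : H) (r : R) := forall o, O o -> `|v - o| <= r.

Lemma covering_radius_midpoint v w r o :
    covering_radius v r -> covering_radius w r -> O o ->
  `|2^-1 *: (v + w) - o| ^+ 2 <= r ^+ 2 - `|v - w| ^+ 2 / 4.
Proof.
move=> vr wr Oo.
have sq u : covering_radius u r -> `|u - o| ^+ 2 <= r ^+ 2.
  move=> /(_ o Oo) uo; rewrite ler_sqr ?nnegrE//.
  exact: le_trans (normr_ge0 _) uo.
have -> : 2^-1 *: (v + w) - o = 2^-1 *: ((v - o) + (w - o)).
  rewrite addrACA -opprD -mulr2n -(scaler_nat 2 o) [RHS]scalerDr scalerN scalerA.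
  by rewrite mulVf ?pnatr_eq0// scale1r.
rewrite normrZ exprMn ger0_norm ?invr_ge0//.
have := parallelogram (v - o) (w - o).
have -> : v - o - (w - o) = v - w by rewrite opprB addrA subrK.
have := sq _ vr; have := sq _ wr; lra.
Qed.

Lemma chebyshev_center N : covering_radius 0 N ->
  exists c r, covering_radius c r /\ forall v, covering_radius v r -> v = c.
Proof.
move=> N0; pose S := [set r | exists v, covering_radius v r].
have S_ge0 r : S r -> 0 <= r.
  by move=> [v vr]; have [z /vr] := O_neq0; apply: le_trans.
have S_inf : has_inf S by split; [exists N, 0|exists 0; exact: S_ge0].
pose rho := inf S.
have rho_ge0 : 0 <= rho by apply: lb_le_inf; [exact: S_inf.1|exact: S_ge0].
have rho_le r : S r -> rho <= r by move=> Sr; apply: ge_inf => //; exact: S_inf.2.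
(* The midpoint cannot beat the infimum [rho], so near-optimal centres are close together; this
   gives both the Cauchy property and uniqueness. *)
have close v w r : covering_radius v r -> covering_radius w r ->
    `|v - w| ^+ 2 <= 4 * (r ^+ 2 - rho ^+ 2).
  move=> vr wr; set q := r ^+ 2 - `|v - w| ^+ 2 / 4.
  have mid o : O o -> `|2^-1 *: (v + w) - o| ^+ 2 <= q.
    exact: covering_radius_midpoint.
  have q_ge0 : 0 <= q by have [z /mid] := O_neq0; apply: le_trans; exact: sqr_ge0.
  have /rho_le : S (Num.sqrt q).
    exists (2^-1 *: (v + w)) => o /mid le; rewrite -(@ger0_norm _ `|_ - o|)//.
    by rewrite -sqrtr_sqr ler_wsqrtr.
  rewrite -ler_sqr ?nnegrE ?sqrtr_ge0// sqr_sqrtr// /q; lra.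
have approx n : exists v, covering_radius v (rho + n.+1%:R^-1).
  have [|r [v vr] rlt] := @inf_adherent _ S n.+1%:R^-1 _ S_inf.
    by rewrite invr_gt0.
  by exists v => o /vr le; exact: le_trans le (ltW rlt).
have /choice[v vP] := approx.
have v_cvg : cvg (v @ \oo).
  apply: cauchy_cvg; apply: cauchy_exP => e e0.
  (* The bound from [close] is [4 * x * (2 * rho + x)] at radius [rho + x]; for [x < d] the cap 1
     controls the second factor and the quotient makes the product less than [e ^+ 2]. *)
  pose d := Num.min 1 (e ^+ 2 / (4 * (2 * rho + 2))).
  have d0 : 0 < d by rewrite lt_min ltr01 divr_gt0 ?exprn_gt0//; lra.
  have [n nd] : exists n : nat, n.+1%:R^-1 < d.
    exists (Num.truncn d^-1).
    rewrite -[ltRHS]invrK ltf_pV2 ?posrE ?invr_gt0// truncnS_gt//.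
  exists (v n); exists n => // m /= lnm.
  rewrite -ball_normE /= -ltr_sqr ?nnegrE ?(ltW e0)//.
  have vm : covering_radius (v m) (rho + n.+1%:R^-1).
    move=> o /(vP m) le; apply: le_trans le _.
    by rewrite lerD2l lef_pV2 ?posrE// ler_nat.
  apply: le_lt_trans (close _ _ _ (vP n) vm) _.
  have n0 : 0 < n.+1%:R^-1 :> R by rewrite invr_gt0.
  move: nd n0; set x := n.+1%:R^-1; rewrite lt_min => /andP[x1].
  rewrite ltr_pdivlMr; last lra.
  nra.
have cP : covering_radius (lim (v @ \oo)) rho.
  move=> o Oo; suff le (e : R) : 0 < e -> `|lim (v @ \oo) - o| <= rho + e.
    exact/ler_addgt0Pr.
  move=> e0.
  have e2 : 0 < e / 2 by rewrite divr_gt0.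
  have lim_near : \forall m \near \oo, `|lim (v @ \oo) - v m| < e / 2.
    by have /cvgrPdist_lt/(_ _ e2) := v_cvg.
  near \oo => m.
  have vc : `|lim (v @ \oo) - v m| < e / 2 by near: m; exact: lim_near.
  have m2 : m.+1%:R^-1 < e / 2.
    by near: m; exact: (near_infty_natSinv_lt (PosNum e2)).
  have := ler_normD (lim (v @ \oo) - v m) (v m - o).
  rewrite addrA subrK => /le_trans; apply.
  have -> : rho + e = e / 2 + (rho + e / 2) by lra.
  rewrite lerD ?(ltW vc)// (le_trans (vP m o Oo))// lerD2l; exact: ltW.
exists (lim (v @ \oo)), rho; split=> // w wr; apply/eqP.
have := close _ _ _ wr cP; rewrite subrr mulr0 => le0.
by rewrite -subr_eq0 -normr_eq0 -sqrf_eq0 eq_le le0 sqr_ge0.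
Unshelve. all: by end_near.
Qed.

End ChebyshevCenter.

Section HilbertFixedPoint.
Import Order.TTheory GRing.Theory Num.Theory.

Lemma bergman_property_FH (G : groupType) k :
  bergman_property G k -> property_FH G.
Proof.
move=> bG R H dot act norm_dot actP act_iso.
have actB g x y : (`|act g x - act g y| = `|x - y|)%R by exact: (act_iso g).2.
have [|n g Wg|m n g h Wg Wh|g|n nP] := bergman_bounded bG
    (W := fun n g => (`|act g 0| <= n%:R)%R).
- by rewrite /= actP.1 normr0.
- by apply: le_trans Wg _; rewrite ler_nat.
- rewrite /= actP.2 -(subrK (act g 0%R) (act g _)) natrD addrC.
  by apply: le_trans (ler_normD _ _) _; rewrite lerD// actB subr0.
- exists (Num.truncn `|act g 0|%R).+1 => /=; exact/ltW/truncnS_gt.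
pose O := [set act g 0%R | g in [set: G]]%classic.
have O_neq0 : (O !=set0)%classic by exists (act 1%g 0%R), 1%g.
have [|c [r [cr c_uniq]]] := chebyshev_center norm_dot O_neq0 (N := n%:R).
  by move=> _ [g _ <-]; rewrite sub0r normrN; exact: nP.
exists c => g; apply: c_uniq => _ [h _ <-].
have -> : act h 0%R = act g (act (g^-1 * h)%g 0%R).
  by rewrite -actP.2 mulVKg.
by rewrite actB; apply: cr; exists (g^-1 * h)%g.
Qed.

End HilbertFixedPoint.

(** * Open subgroups for pointwise convergence *)

Section PointwiseTopology.
Variables (V : choiceType) (E : rel V).
Local Open Scope classical_set_scope.

Lemma open_point_image (v w : V) : open [set g : automorphism E | g v = w].
Proof.
have /continuousP ev_cont : continuous
    (@aut_fun V E : automorphism E -> {ptws V -> discrete_topology V}).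
  exact: initial_continuous.
have /continuousP proj_cont : continuous (@proj V (fun=> discrete_topology V) v :
    {ptws V -> discrete_topology V} -> discrete_topology V).
  exact: proj_continuous.
exact: (ev_cont _ (proj_cont [set w] (discrete_open _))).
Qed.

Lemma open_subgroup (H : set (automorphism E)) (A : seq V) : is_subgroup H ->
  (forall g : automorphism E, {in A, forall v, g v = v} -> H g) -> open H.
Proof.
move=> /subgroupP[_ HM _] AH; rewrite openE => h Hh.
have agree : nbhs h [set g : automorphism E | {in A, g =1 h}].
  elim: A {AH} => [|v A IHA]; first by apply: filterS (@filterT _ _ _) => g _ v.
  have hv : nbhs h [set g : automorphism E | g v = h v].
    by apply: open_nbhs_nbhs; split=> //; exact: open_point_image.
  apply: filterS (filterI hv IHA) => g [gv gA] u.
  by rewrite inE => /orP[/eqP->|/gA].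
apply: filterS agree => g gA; rewrite -(mulVKg h g); apply: HM => //.
by apply: AH => v vA /=; rewrite gA// aut_funK.
Qed.

End PointwiseTopology.

Theorem corollary1p7 (V : choiceType) (E : rel V)
    (hE : is_fraisse_limit E (fun T e => omega_partite_tournament e) \/
          is_fraisse_limit E (fun T e => semigeneric_tournament e)) :
  [/\ small_index_property (@open (automorphism E)),
      uncountable_cofinality (automorphism E),
      property_FA (automorphism E) /\ property_FH (automorphism E)
    & bergman_property (automorphism E) 21].
Proof.
have [sg [V_countable E_hom E_age]] : exists sg, [/\ countable [set: V]%classic,
    homogeneous E & forall (T : finType) (e : rel T),
      embeds E e <-> tournament_class sg e].
  case: hE => -[? ? age]; [exists false|exists true]; split=> // T e.
    by split=> [/age/(tournament_classP false)|/(tournament_classP false)/age].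
  by split=> [/age/(tournament_classP true)|/(tournament_classP true)/age].
have bergman := limit_bergman V_countable E_hom E_age.
split=> //; [|exact: bergman_uncountable_cofinality bergman|].
- move=> H Hs le ne; have [A AH] := limit_small_index V_countable E_hom E_age Hs le ne.
  exact: open_subgroup AH.
- by split; [exact: bergman_property_FA bergman|exact: bergman_property_FH bergman].
Qed.
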